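(* Let $F:\mathbb{P}^N_{\mathbb{C}_p}\to\mathbb{P}^N_{\mathbb{C}_p}$ be a lift of Frobenius on $\mathbb{P}^N_{\mathbb{C}_p}$, and let $\mathrm{Per}$ be the set of periodic closed points of $F$. Let $V$ be any irreducible subvariety of $\mathbb{P}^N_{\mathbb{C}_p}$. Then there exists $\delta>0$ such that for any point $x\in \mathrm{Per}$, either $d(x,V)>\delta$ or $x\in V$.
   Context: $p$ is a prime and $\mathbb{C}_p$ is the completion of an algebraic closure of $\mathbb{Q}_p$, with norm $|\cdot|$, valuation ring $\mathbb{C}_p^{\circ}$ and maximal ideal $\mathbb{C}_p^{\circ\circ}$. A lift of Frobenius on $\mathbb{P}^N_{\mathbb{C}_p}$ is an endomorphism of the form $$F:[x_0:\cdots:x_N]\mapsto [x_0^q+p'P_0(x_0,\dots,x_N):\cdots:x_N^q+p'P_N(x_0,\dots,x_N)],$$ where $q=p^s$ with $s\geq 1$, $p'\in\mathbb{C}_p^{\circ\circ}$, and $P_0,\dots,P_N\in\mathbb{C}_p^{\circ}[x_0,\dots,x_N]$ are homogeneous polynomials of degree $q$. A point $x$ is periodic if $F^n(x)=x$ for some $n>0$. Distance to a subvariety: for a subvariety $V$ of $\mathbb{P}^N_{\mathbb{C}_p}$, fix homogeneous polynomials $H_1,\dots,H_m\in\mathbb{C}_p[x_0,\dots,x_N]$ defining $V$ with $\|H_i\|=1$ (Gauss norm, i.e. maximum of the absolute values of the coefficients). For $y\in\mathbb{P}^N(\mathbb{C}_p)$ write $y=[y_0:\cdots:y_N]$ with $\max_i|y_i|=1$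 and set $d(y,V):=\max_{1\le i\le m}|H_i(y_0,\dots,y_N)|$ (with $d(y,V)=0$ if $m=0$, i.e. if $V=\mathbb{P}^N$). *)

(* Defs.v *)
From HB Require Import structures.
From mathcomp Require Import all_boot all_order all_algebra.
From mathcomp Require Import reals.
From mathcomp Require Import mpoly.

Set Implicit Arguments.
Unset Strict Implicit.
Unset Printing Implicit Defensive.

Import Order.TTheory GRing.Theory Num.Theory.
Local Open Scope ring_scope.

(* C_p is handled up to isometric isomorphism: a valued field is "C_p" when it
   sits at the top of a tower
     rat --completion--> Q_p --algebraic closure--> Qbar_p --completion--> C_p
   in which the absolute value of each field extends that of the previous one
   and the one on rat is the p-adic one, normalised by |p| = 1/p. *)

Record ultrametric_abs (R : realType) (K : fieldType) (nu : K -> R) : Prop :=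
  UltrametricAbs {
    ultra_ge0 : forall x, 0 <= nu x;
    ultra_eq0 : forall x, nu x = 0 <-> x = 0;
    ultraM : forall x y, nu (x * y) = nu x * nu y;
    ultraD : forall x y, nu (x + y) <= Num.max (nu x) (nu y)
  }.

Definition cauchy_seq (R : realType) (K : fieldType) (nu : K -> R)
    (u : nat -> K) : Prop :=
  forall e : R, 0 < e ->
  exists n0, forall m n, (n0 <= m)%N -> (n0 <= n)%N -> nu (u m - u n) < e.

Definition seq_limit (R : realType) (K : fieldType) (nu : K -> R)
    (u : nat -> K) (l : K) : Prop :=
  forall e : R, 0 < e -> exists n0, forall n, (n0 <= n)%N -> nu (u n - l) < e.

Record is_completion (R : realType) (k K : fieldType) (nuk : k -> R)
    (nuK : K -> R) (i : {rmorphism k -> K}) : Prop := IsCompletion {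
  completion_abs : ultrametric_abs nuK;
  completion_isometry : forall x, nuK (i x) = nuk x;
  completion_dense : forall (x : K) (e : R), 0 < e ->
    exists y : k, nuK (x - i y) < e;
  completion_complete : forall u, cauchy_seq nuK u ->
    exists l, seq_limit nuK u l
}.

Record is_algebraic_closure (k L : fieldType) (i : {rmorphism k -> L}) : Prop :=
  IsAlgebraicClosure {
    algclosure_algebraic : forall x : L, algebraicOver i x;
    algclosure_closed : GRing.closed_field_axiom L
  }.

Definition padic_abs (R : realType) (p : nat) (x : rat) : R :=
  if x == 0 then 0
  else p%:R ^ ((logn p `|denq x|%N)%:Z - (logn p `|numq x|%N)%:Z).

Definition is_Cp (R : realType) (p : nat) (Cp : fieldType) (nu : Cp -> R) :
    Prop :=
  exists (Qp Qpbar : fieldType) (nuQp : Qp -> R) (nuQpbar : Qpbar -> R)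
         (i : {rmorphism rat -> Qp}) (j : {rmorphism Qp -> Qpbar})
         (k : {rmorphism Qpbar -> Cp}),
    [/\ is_completion (padic_abs R p) nuQp i,
        is_algebraic_closure j,
        ultrametric_abs nuQpbar,
        forall x, nuQpbar (j x) = nuQp x
      & is_completion nuQpbar nu k].

(* Points of P^N over K are the lines of K^(N+1).  When K is algebraically
   closed these are exactly the closed points of the scheme P^N. *)
Definition proj_space (K : fieldType) (N : nat) : Type :=
  {L : {vspace 'rV[K]_N.+1} | \dim L == 1%N}.

Definition hcoords (K : fieldType) (N : nat) (y : 'rV[K]_N.+1)
    (x : proj_space K N) : Prop :=
  y != 0 /\ <[y]>%VS = val x.

Definition is_homogeneous (K : fieldType) (n : nat) (H : {mpoly K[n]}) : Prop :=
  exists d : nat, H \is d.-homog.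

Definition eval_at (K : fieldType) (n : nat) (H : {mpoly K[n]})
    (y : 'rV[K]_n) : K := H.@[y 0].

Definition zero_locus (K : fieldType) (N m : nat)
    (H : 'I_m -> {mpoly K[N.+1]}) (x : proj_space K N) : Prop :=
  forall y, hcoords y x -> forall j, eval_at (H j) y = 0.

Definition zariski_closed (K : fieldType) (N : nat)
    (Z : proj_space K N -> Prop) : Prop :=
  exists (m : nat) (H : 'I_m -> {mpoly K[N.+1]}),
    (forall j, is_homogeneous (H j)) /\ (forall x, Z x <-> zero_locus H x).

Record irreducible_subvariety (K : fieldType) (N : nat)
    (V : proj_space K N -> Prop) : Prop := IrreducibleSubvariety {
  subvar_closed : zariski_closed V;
  subvar_nonempty : exists x, V x;
  subvar_irreducible : forall Z1 Z2 : proj_space K N -> Prop,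
    zariski_closed Z1 -> zariski_closed Z2 ->
    (forall x, V x -> Z1 x \/ Z2 x) ->
    (forall x, V x -> Z1 x) \/ (forall x, V x -> Z2 x)
}.

Definition frobenius_coords (K : fieldType) (N q : nat) (p' : K)
    (P : 'I_N.+1 -> {mpoly K[N.+1]}) (y : 'rV[K]_N.+1) : 'rV[K]_N.+1 :=
  \row_i (y 0 i ^+ q + p' * eval_at (P i) y).

Definition frobenius_lift (R : realType) (p : nat) (K : fieldType)
    (nu : K -> R) (N : nat) (F : proj_space K N -> proj_space K N) : Prop :=
  exists (s : nat) (p' : K) (P : 'I_N.+1 -> {mpoly K[N.+1]}),
    [/\ (1 <= s)%N,
        nu p' < 1,
        forall i, P i \is (p ^ s)%N.-homog,
        forall i mon, nu (P i)@_mon <= 1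
      & forall y x, hcoords y x ->
          hcoords (frobenius_coords (p ^ s)%N p' P y) (F x)].

Definition periodic (T : Type) (F : T -> T) (x : T) : Prop :=
  exists2 n : nat, (0 < n)%N & iter n F x = x.

Definition gauss_norm (R : realType) (K : fieldType) (nu : K -> R) (n : nat)
    (H : {mpoly K[n]}) : R :=
  \big[Num.max/0]_(mon <- msupp H) nu H@_mon.

Definition sup_norm (R : realType) (K : fieldType) (nu : K -> R) (n : nat)
    (y : 'rV[K]_n) : R :=
  \big[Num.max/0]_i nu (y 0 i).

(* Some homogeneous coordinates divided by an entry of maximal absolute value;
   see [norm_coordsP]. *)
Definition norm_coords (R : realType) (K : fieldType) (nu : K -> R) (N : nat)
    (x : proj_space K N) : 'rV[K]_N.+1 :=
  let y := vpick (val x) in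
  (y 0 [arg max_(i > ord0) nu (y 0 i)]%O)^-1 *: y.

(* The distance depends on the chosen equations [H] of the subvariety, but not
   on the normalised coordinates; see [distE]. *)
Definition dist (R : realType) (K : fieldType) (nu : K -> R) (N m : nat)
    (H : 'I_m -> {mpoly K[N.+1]}) (x : proj_space K N) : R :=
  \big[Num.max/0]_j nu (eval_at (H j) (norm_coords nu x)).

Lemma ultra1 (R : realType) (K : fieldType) (nu : K -> R) :
  ultrametric_abs nu -> nu 1 = 1.
Proof.
move=> nuA; have nz : nu 1 != 0.
  by apply/eqP => /(ultra_eq0 nuA)/eqP; rewrite oner_eq0.
by apply: (mulfI nz); rewrite -(ultraM nuA) !mulr1.
Qed.

Lemma hcoords_scale (K : fieldType) (N : nat) (y z : 'rV[K]_N.+1)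
    (x : proj_space K N) :
  hcoords y x -> hcoords z x -> exists2 c : K, c != 0 & z = c *: y.
Proof.
move=> [y0 yx] [z0 zx]; have : z \in <[y]>%VS by rewrite yx -zx memv_line.
case/vlineP => c zE; exists c => //.
by apply: contra_neq z0 => c0; rewrite zE c0 scale0r.
Qed.

Lemma hcoordsZ (K : fieldType) (N : nat) (c : K) (y : 'rV[K]_N.+1)
    (x : proj_space K N) :
  c != 0 -> hcoords y x -> hcoords (c *: y) x.
Proof.
move=> c0 [y0 yx]; split; first by rewrite scaler_eq0 negb_or c0.
rewrite -yx; apply/eqP; rewrite eqEdim -memvE memvZ ?memv_line //=.
by rewrite !dim_vline scaler_eq0 (negPf c0) (negPf y0).
Qed.

Lemma hcoords_vpick (K : fieldType) (N : nat) (x : proj_space K N) :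
  hcoords (vpick (val x)) x.
Proof.
have dx : \dim (val x) = 1%N by apply/eqP; exact: (valP x).
have y0 : vpick (val x) != 0 by rewrite vpick0 -dimv_eq0 dx.
split=> //; apply/eqP; rewrite eqEdim -memvE memv_pick dx.
by rewrite dim_vline y0.
Qed.

Lemma norm_coordsP (R : realType) (K : fieldType) (nu : K -> R) (N : nat)
    (x : proj_space K N) :
  ultrametric_abs nu ->
  hcoords (norm_coords nu x) x /\ sup_norm nu (norm_coords nu x) = 1.
Proof.
move=> nuA; have [y0 yx] := hcoords_vpick x.
rewrite /norm_coords; set y := vpick _ in y0 yx *.
case: arg_maxP => //= i _ imax.
have yi0 : y 0 i != 0.
  apply: contra_neq y0 => yi0; apply/rowP => k; rewrite mxE.
  apply/(ultra_eq0 nuA)/eqP; rewrite eq_le (ultra_ge0 nuA) andbT.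
  by have := imax k isT; rewrite yi0 (ultra_eq0 nuA 0).2.
split; first by apply: hcoordsZ; [rewrite invr_neq0 | split].
apply/eqP; rewrite eq_le; apply/andP; split.
  apply: (big_ind (fun t => t <= 1)) => // [a b a1 b1|k _].
    by rewrite ge_max a1.
  have nuV : nu (y 0 i)^-1 * nu (y 0 i) = 1.
    by rewrite -(ultraM nuA) mulVf // ultra1.
  rewrite mxE (ultraM nuA) -nuV ler_wpM2l ?(ultra_ge0 nuA) //.
  exact: imax.
rewrite /sup_norm (bigD1 i) //= le_max mxE mulVf // ultra1 // lexx //.
Qed.

Lemma eval_atZ (K : fieldType) (n d : nat) (H : {mpoly K[n]}) (c : K)
    (y : 'rV[K]_n) :
  H \is d.-homog -> eval_at H (c *: y) = c ^+ d * eval_at H y.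
Proof.
move=> Hd; rewrite /eval_at !mevalE mulr_sumr; apply: eq_big_seq => mon Hm.
rewrite mulrCA; congr (_ * _).
rewrite -(dhomog_mf Hd Hm) /=.
under eq_bigr do rewrite mxE exprMn.
rewrite big_split /=; congr (_ * _).
by rewrite mdegE (big_morph _ (exprD c) (expr0 c)).
Qed.

Lemma distE (R : realType) (K : fieldType) (nu : K -> R) (N m : nat)
    (H : 'I_m -> {mpoly K[N.+1]}) (x : proj_space K N) (y : 'rV[K]_N.+1) :
  ultrametric_abs nu -> (forall j, is_homogeneous (H j)) ->
  hcoords y x -> sup_norm nu y = 1 ->
  dist nu H x = \big[Num.max/0]_j nu (eval_at (H j) y).
Proof.
move=> nuA Hh yx y1; have [zx z1] := norm_coordsP x nuA.
have [c c0 zE] := hcoords_scale yx zx.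
have nuc : nu c = 1.
  have : sup_norm nu (norm_coords nu x) = nu c * sup_norm nu y.
    rewrite zE /sup_norm.
    under eq_bigr do rewrite mxE (ultraM nuA).
    rewrite (big_morph _ (fun a b => maxr_pMr a b (ultra_ge0 nuA c)) (mulr0 _)) //.
  by rewrite z1 y1 mulr1.
apply: eq_bigr => j _; have [d Hd] := Hh j.
rewrite zE (eval_atZ _ _ Hd) (ultraM nuA).
suff -> : nu (c ^+ d) = 1 by rewrite mul1r.
elim: d {Hd} => [|d IH]; first by rewrite expr0 ultra1.
by rewrite exprS (ultraM nuA) nuc IH mulr1.
Qed.

(* Main.v *)
Require Import Defs.
From HB Require Import structures.
From mathcomp Require Import all_boot all_order all_algebra.
From mathcomp Require Import reals boolp.
From mathcomp Require Import mpoly ring lra.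

(** Idea.  Let T be the set of Teichmueller points t of C_p (those with
    t = t^(p^n) for some n > 0) and W the subring they generate, whose absolute
    values are powers of |p|.  For a polynomial G and eps > 0, the points of T^n
    with |G| <= eps are the zeros, modulo the maximal ideal, of integral
    polynomials: divide G by its largest coefficient, record the reduction, and
    subtract a p-power of a lift of that reduction.  The Gauss norm drops while
    the coefficients stay in a fixed finitely generated W-module, whose norms
    above eps are well-founded, so the process stops.

    A lift of Frobenius F contracts residue discs.  Hence a periodic point is
    determined up to eps by the Teichmueller approximation of a preimage of it
    under a high iterate of F, and the periodic points at distance <= eps from V
    are cut out modulo the maximal ideal by an ideal that grows as eps decreases.
    By Noetherianity over the residue field these ideals are eventually
    constant: a periodic point close enough to V is at distance 0 from it. *)

Set Implicit Arguments.
Unset Strict Implicit.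
Unset Printing Implicit Defensive.

Import Order.TTheory GRing.Theory Num.Theory.
Local Open Scope ring_scope.

(** * Subrings and the Frobenius map modulo p *)

Record is_subring (A : comNzRingType) (S : A -> Prop) : Prop := IsSubring {
  subring1 : S 1;
  subringB : forall x y, S x -> S y -> S (x - y);
  subringM : forall x y, S x -> S y -> S (x * y)
}.

Section Subring.
Variables (A : comNzRingType) (S : A -> Prop).
Hypothesis subS : is_subring S.

Lemma subring0 : S 0.
Proof. by rewrite -(subrr 1); apply: subringB => //; exact: subring1. Qed.

Lemma subringN x : S x -> S (- x).
Proof. by move=> Sx; rewrite -sub0r; apply: subringB => //; exact: subring0. Qed.

Lemma subringD x y : S x -> S y -> S (x + y).
Proof. by move=> Sx Sy; rewrite -[y]opprK; apply: subringB => //; exact: subringN. Qed.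

Lemma subring_sum (I : Type) (s : seq I) (P : pred I) (F : I -> A) :
  (forall i, P i -> S (F i)) -> S (\sum_(i <- s | P i) F i).
Proof.
move=> SF; elim/big_ind: _ => //; [exact: subring0 | exact: subringD].
Qed.

Lemma subringX x n : S x -> S (x ^+ n).
Proof.
move=> Sx; elim: n => [|n IH]; first by rewrite expr0; exact: subring1.
by rewrite exprS; apply: subringM.
Qed.

Lemma subringMn x n : S x -> S (x *+ n).
Proof.
move=> Sx; elim: n => [|n IH]; first by rewrite mulr0n; exact: subring0.
by rewrite mulrS; apply: subringD.
Qed.

Lemma subring_nat n : S n%:R.
Proof. by apply: subringMn; exact: subring1. Qed.

Variable p : nat.
Hypothesis p_pr : prime p.

(** The inner binomial coefficients are divisible by [p]. Keeping the error in [p%:R * S] for any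
    subring [S] lets one congruence serve the valuation ring, the ring W and polynomials over W. *)
Lemma frobD1 a b : S a -> S b ->
  exists2 c, S c & (a + b) ^+ p = a ^+ p + b ^+ p + p%:R * c.
Proof.
case: p p_pr => [//|m] m_pr Sa Sb.
exists (\sum_(i < m) (a ^+ (m.+1 - i.+1) * b ^+ i.+1) *+ ('C(m.+1, i.+1) %/ m.+1)).
  by apply: subring_sum => i _; apply: subringMn; apply: subringM => //; apply: subringX.
rewrite exprDn big_ord_recl big_ord_recr /= bin0 subn0 mulr1n mulr1 -addrA.
congr (_ + _); rewrite /bump /= add1n subnn binn mul1r mulr1n addrC.
congr (_ + _); rewrite mulr_sumr; apply: eq_bigr => i _; rewrite add1n.
by rewrite mulr_natl -mulrnA divnK // prime_dvd_bin //= ltnS.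
Qed.

Lemma frobD r a b : S a -> S b ->
  exists2 c, S c & (a + b) ^+ (p ^ r) = a ^+ (p ^ r) + b ^+ (p ^ r) + p%:R * c.
Proof.
move=> Sa Sb; elim: r => [|r [c Sc IH]].
  by exists 0; [exact: subring0 | rewrite expn0 !expr1 mulr0 addr0].
have Sp x : S x -> S (x ^+ (p ^ r)) by exact: subringX.
have Spc : S (p%:R * c) by apply: subringM => //; exact: subring_nat.
have [c1 Sc1 E1] := frobD1 (subringD (Sp _ Sa) (Sp _ Sb)) Spc.
have [c2 Sc2 E2] := frobD1 (Sp _ Sa) (Sp _ Sb).
exists (c2 + (p%:R ^+ p.-1 * c ^+ p + c1)).
  apply: subringD => //; apply: subringD => //.
  by apply: subringM => //; apply: subringX => //; exact: subring_nat.
have pE : p%:R * p%:R ^+ p.-1 = p%:R ^+ p :> A.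
  by rewrite -exprS prednK // prime_gt0.
rewrite expnSr !exprM IH E1 E2 exprMn -pE !mulrDr !mulrA !addrA.
by [].
Qed.

Lemma frobB r a b : S a -> S b ->
  exists2 c, S c & (a - b) ^+ (p ^ r) = a ^+ (p ^ r) - b ^+ (p ^ r) + p%:R * c.
Proof.
move=> Sa Sb; have [c Sc E] := frobD r (subringB subS Sa Sb) Sb.
exists (- c); first exact: subringN.
by rewrite subrK in E; rewrite E; ring.
Qed.

Lemma frob_sum r (I : Type) (s : seq I) (F : I -> A) : (forall i, S (F i)) ->
  exists2 c, S c &
    (\sum_(i <- s) F i) ^+ (p ^ r) = \sum_(i <- s) F i ^+ (p ^ r) + p%:R * c.
Proof.
move=> SF; elim: s => [|i s [c Sc IH]].
  exists 0; first exact: subring0.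
  by rewrite !big_nil expr0n expn_eq0 eqn0Ngt prime_gt0 //= mulr0 addr0.
have [c1 Sc1 E] := frobD r (SF i) (subring_sum s (fun j (_ : xpredT j) => SF j)).
exists (c + c1); first exact: subringD.
by rewrite !big_cons E IH mulrDr !addrA.
Qed.

End Subring.

(** * Ultrametric absolute values and congruences between powers *)

Section Ultrametric.
Variables (R : realType) (K : fieldType) (nu : K -> R).
Hypothesis nuA : ultrametric_abs nu.

Lemma nu_ge0 x : 0 <= nu x. Proof. exact: ultra_ge0. Qed.
Lemma nu0 : nu 0 = 0. Proof. exact/(ultra_eq0 nuA). Qed.
Lemma nu_eq0 x : (nu x == 0) = (x == 0).
Proof. by apply/eqP/eqP => /(ultra_eq0 nuA). Qed.
Lemma nu_gt0 x : (0 < nu x) = (x != 0).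
Proof. by rewrite lt_def nu_ge0 andbT nu_eq0. Qed.
Lemma nu1 : nu 1 = 1. Proof. exact: ultra1. Qed.
Lemma nuM x y : nu (x * y) = nu x * nu y. Proof. exact: ultraM. Qed.
Lemma nuX x n : nu (x ^+ n) = nu x ^+ n.
Proof. by elim: n => [|n IH]; rewrite ?expr0 ?nu1 // !exprS nuM IH. Qed.
Lemma nuV x : nu x^-1 = (nu x)^-1.
Proof.
have [->|x0] := eqVneq x 0; first by rewrite invr0 nu0 invr0.
by apply: (mulfI (x := nu x)); rewrite ?nu_eq0 // -nuM !mulfV ?nu_eq0 // nu1.
Qed.
Lemma nuN x : nu (- x) = nu x.
Proof.
apply/eqP; rewrite -(eqrXn2 (n := 2)) ?nu_ge0 //.
by rewrite -!nuX sqrrN.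
Qed.
Lemma nu_distC x y : nu (x - y) = nu (y - x).
Proof. by rewrite -nuN opprB. Qed.

Lemma nuD_le c x y : nu x <= c -> nu y <= c -> nu (x + y) <= c.
Proof. by move=> xc yc; apply: le_trans (ultraD nuA x y) _; rewrite ge_max xc. Qed.
Lemma nuD_lt c x y : nu x < c -> nu y < c -> nu (x + y) < c.
Proof. by move=> xc yc; apply: le_lt_trans (ultraD nuA x y) _; rewrite gt_max xc. Qed.
Lemma nuB_le c x y : nu x <= c -> nu y <= c -> nu (x - y) <= c.
Proof. by move=> xc yc; apply: nuD_le; rewrite ?nuN. Qed.
Lemma nuB_lt c x y : nu x < c -> nu y < c -> nu (x - y) < c.
Proof. by move=> xc yc; apply: nuD_lt; rewrite ?nuN. Qed.

Lemma nu_dist_le c y x z :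
  nu (x - y) <= c -> nu (y - z) <= c -> nu (x - z) <= c.
Proof. by move=> xy yz; rewrite -(subrK y x) -addrA; apply: nuD_le. Qed.
Lemma nu_dist_lt c y x z :
  nu (x - y) < c -> nu (y - z) < c -> nu (x - z) < c.
Proof. by move=> xy yz; rewrite -(subrK y x) -addrA; apply: nuD_lt. Qed.
Lemma nu_near_le c x y : nu (x - y) <= c -> nu y <= c -> nu x <= c.
Proof. by move=> xy yc; rewrite -(subrK y x); apply: nuD_le. Qed.
Lemma nu_near_lt c x y : nu (x - y) < c -> nu y < c -> nu x < c.
Proof. by move=> xy yc; rewrite -(subrK y x); apply: nuD_lt. Qed.
Lemma nu_near_eq x y : nu (x - y) < nu y -> nu x = nu y.
Proof.
move=> xy; apply/eqP; rewrite eq_le (nu_near_le (ltW xy)) //= leNgt.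
apply/negP => lt; have : nu y < nu y.
  by apply: nu_near_lt lt; rewrite nu_distC.
by rewrite ltxx.
Qed.

Lemma nu_sum_le (I : Type) (s : seq I) (P : pred I) (F : I -> K) c : 0 <= c ->
  (forall i, P i -> nu (F i) <= c) -> nu (\sum_(i <- s | P i) F i) <= c.
Proof.
move=> c0 Fc; elim/big_ind: _ => //; first by rewrite nu0.
by move=> x y; exact: nuD_le.
Qed.

Lemma nu_sum_lt (I : Type) (s : seq I) (P : pred I) (F : I -> K) c : 0 < c ->
  (forall i, P i -> nu (F i) < c) -> nu (\sum_(i <- s | P i) F i) < c.
Proof.
move=> c0 Fc; elim/big_ind: _ => //; first by rewrite nu0.
by move=> x y; exact: nuD_lt.
Qed.

Lemma nuM_le1 x y : nu x <= 1 -> nu y <= 1 -> nu (x * y) <= 1.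
Proof. by move=> x1 y1; rewrite nuM mulr_ile1 ?nu_ge0. Qed.
Lemma nuX_le1 x n : nu x <= 1 -> nu (x ^+ n) <= 1.
Proof. by move=> x1; rewrite nuX exprn_ile1 ?nu_ge0. Qed.

Lemma nuX_lt1 x n : (0 < n)%N -> (nu (x ^+ n) < 1) = (nu x < 1).
Proof. by move=> n0; rewrite nuX expr_lt1 ?nu_ge0. Qed.

Lemma subring_int : is_subring (fun x => nu x <= 1).
Proof.
split; first by rewrite nu1.
  by move=> x y; exact: nuB_le.
by move=> x y; exact: nuM_le1.
Qed.

Lemma nu_nat_le1 n : nu n%:R <= 1.
Proof. exact: (subring_nat subring_int). Qed.

Lemma nu_prod_le1 (I : Type) (s : seq I) (F : I -> K) :
  (forall i, nu (F i) <= 1) -> nu (\prod_(i <- s) F i) <= 1.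
Proof.
move=> F1; elim/big_ind: _ => //; first by rewrite nu1.
by move=> x y; exact: nuM_le1.
Qed.

Lemma distX_le a b n : nu a <= 1 -> nu b <= 1 -> nu (a ^+ n - b ^+ n) <= nu (a - b).
Proof.
move=> a1 b1; rewrite subrXX nuM ler_piMr ?nu_ge0 //.
by apply: nu_sum_le => // i _; apply: nuM_le1; apply: nuX_le1.
Qed.

Variable p : nat.
Hypotheses (p_pr : prime p) (p_lt1 : nu p%:R < 1).

(** In the factorisation of [a ^+ p - b ^+ p] the cofactor of [a - b] is congruent to
    [p%:R * b ^+ p.-1] modulo [a - b], so its norm is at most [rho]. *)
Lemma distXp_le rho a b : nu p%:R <= rho -> nu a <= 1 -> nu b <= 1 ->
  nu (a - b) <= rho -> nu (a ^+ p - b ^+ p) <= rho * nu (a - b).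
Proof.
move=> prho a1 b1 abrho; rewrite subrXX nuM mulrC ler_wpM2r ?nu_ge0 //.
have rho0 : 0 <= rho by apply: le_trans prho; exact: nu_ge0.
have -> : \sum_(i < p) a ^+ (p.-1 - i) * b ^+ i =
    \sum_(i < p) (a ^+ (p.-1 - i) - b ^+ (p.-1 - i)) * b ^+ i + p%:R * b ^+ p.-1.
  have -> : p%:R * b ^+ p.-1 = \sum_(i < p) b ^+ (p.-1 - i) * b ^+ i.
    transitivity (\sum_(i < p) b ^+ p.-1); first by rewrite sumr_const card_ord mulr_natl.
    apply: eq_bigr => i _; rewrite -exprD subnK //.
    by rewrite -ltnS prednK ?prime_gt0.
  by rewrite -big_split /=; apply: eq_bigr => i _; rewrite mulrBl subrK.
apply: nuD_le; last first.
  by rewrite nuM; apply: le_trans prho; rewrite ler_piMr ?nu_ge0 ?nuX_le1.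
apply: nu_sum_le => // i _; rewrite nuM; apply: le_trans abrho.
apply: le_trans (distX_le (p.-1 - i) a1 b1); rewrite ler_piMr ?nu_ge0 ?nuX_le1 //.
Qed.

Lemma distXpn_le rho a b r : nu p%:R <= rho -> rho <= 1 -> nu a <= 1 -> nu b <= 1 ->
  nu (a - b) <= rho -> nu (a ^+ (p ^ r) - b ^+ (p ^ r)) <= rho ^+ r * nu (a - b).
Proof.
move=> prho rho1 a1 b1 abrho; elim: r => [|r IH].
  by rewrite expn0 !expr1 expr0 mul1r.
have rho0 : 0 <= rho by apply: le_trans prho; exact: nu_ge0.
rewrite expnSr !exprM exprS -mulrA.
apply: le_trans (distXp_le prho _ _ _) _; rewrite ?nuX_le1 ?ler_wpM2l //.
by apply: le_trans (distX_le _ a1 b1) _.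
Qed.

Lemma frobB_mod r a b : nu a <= 1 -> nu b <= 1 ->
  nu ((a - b) ^+ (p ^ r) - (a ^+ (p ^ r) - b ^+ (p ^ r))) < 1.
Proof.
move=> a1 b1; have [c c1 ->] := frobB subring_int p_pr r a1 b1.
rewrite addrC addKr nuM; apply: le_lt_trans p_lt1.
by rewrite ler_piMr ?nu_ge0.
Qed.

(** Frobenius is additive modulo the maximal ideal, and the residue ring has no nilpotents. *)
Lemma frob_inj_mod r a b : nu a <= 1 -> nu b <= 1 ->
  nu (a ^+ (p ^ r) - b ^+ (p ^ r)) < 1 -> nu (a - b) < 1.
Proof.
move=> a1 b1 ab; rewrite -(nuX_lt1 _ (n := (p ^ r)%N)) ?expn_gt0 ?prime_gt0 //.
exact: nu_near_lt (frobB_mod _ a1 b1) ab.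
Qed.

End Ultrametric.

Lemma expr_small (R : realType) (c e : R) : 0 <= c -> c < 1 -> 0 < e ->
  exists N, forall n, (N <= n)%N -> c ^+ n <= e.
Proof.
move=> c0 c1 e0; have cn n : 0 <= c ^+ n by exact: exprn_ge0.
have cn1 n : c ^+ n <= 1 by exact: exprn_ile1 (ltW c1).
(* [1 - c ^+ n] is [1 - c] times a sum of [n] powers of [c], each at least [c ^+ n]. *)
have bound n : n%:R * (1 - c) * c ^+ n <= 1 - c ^+ n.
  elim: n => [|n IH]; first by rewrite expr0 mul0r mul0r subrr.
  rewrite exprS -natr1; have := cn n; have := cn1 n; move: (c ^+ n) IH => x IH x1 x0.
  have cx1 : c * x <= 1 by apply: mulr_ile1 => //; exact: ltW.
  have : 0 <= (1 - c) * (1 - c * x) by rewrite mulr_ge0 ?subr_ge0 // ltW.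
  by have := ler_wpM2l c0 IH; lra.
have d0 : 0 < (1 - c) * e by rewrite mulr_gt0 ?subr_gt0.
have := archi_boundP (ltW (divr_gt0 ltr01 d0)).
move: (Num.Def.archi_bound _) => N; rewrite ltr_pdivrMr // => Ne.
exists N => n Nn; apply: le_trans (ler_wiXn2l c0 (ltW c1) Nn) _.
have := bound N; have := cn N; have := cn1 N; move: (c ^+ N) => x x1 x0 b.
rewrite leNgt; apply/negP => ex.
have : N%:R * ((1 - c) * e) <= N%:R * ((1 - c) * x).
  by rewrite !ler_wpM2l ?ler0n ?subr_ge0 // ltW.
lra.
Qed.

(** * Teichmueller points and the ring W that they generate *)

Section Teichmueller.
Variables (R : realType) (K : fieldType) (nu : K -> R).
Hypothesis nuA : ultrametric_abs nu.
Variable p : nat.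
Hypotheses (p_pr : prime p) (p_lt1 : nu p%:R < 1) (p_nz : p%:R != 0 :> K).

Definition teich (t : K) : Prop := exists2 n, (0 < n)%N & t ^+ (p ^ n) = t.

Lemma expr_iter (t : K) n k : t ^+ (p ^ n) = t -> t ^+ (p ^ (n * k)) = t.
Proof.
move=> tn; elim: k => [|k IH]; first by rewrite muln0 expn0 expr1.
by rewrite mulnS expnD exprM tn IH.
Qed.

Lemma teich1 : teich 1. Proof. by exists 1%N => //; rewrite expr1n. Qed.

Lemma teichM t u : teich t -> teich u -> teich (t * u).
Proof.
move=> [n n0 tn] [m m0 um]; exists (n * m)%N; first by rewrite muln_gt0 n0.
by rewrite exprMn expr_iter // mulnC expr_iter.
Qed.

Lemma teichX t k : teich t -> teich (t ^+ k).
Proof. by case=> n n0 tn; exists n => //; rewrite exprAC tn. Qed.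

Lemma teichV t : teich t -> teich t^-1.
Proof. by case=> n n0 tn; exists n => //; rewrite exprVn tn. Qed.

(** As [t] equals its own [p ^ (n * r)]-th power, the root is found among the powers of [t]. *)
Lemma teich_root r t : teich t -> exists2 u, teich u & u ^+ (p ^ r) = t.
Proof.
move=> tT; have [n n0 tn] := tT; exists (t ^+ (p ^ (n * r - r))); first exact: teichX.
by rewrite -exprM -expnD subnK ?expr_iter // leq_pmull.
Qed.

Lemma teich_roots r (T : Type) (t : T -> K) : (forall x, teich (t x)) ->
  exists2 u : T -> K, forall x, teich (u x) & (fun x => u x ^+ (p ^ r)) =1 t.
Proof.
move=> tT; have [x|u uP] :=
    @choice _ _ (fun x y => teich y /\ y ^+ (p ^ r) = t x).
  by have [y yT yE] := teich_root r (tT x); exists y.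
by exists u => x; case: (uP x).
Qed.

(** A nonzero Teichmueller point is a root of unity. *)
Lemma teich_norm t : teich t -> t = 0 \/ nu t = 1.
Proof.
case=> n n0 tn; have [->|t0] := eqVneq t 0; [by left | right].
have P1 : (1 < p ^ n)%N by rewrite -(exp1n n) ltn_exp2r // prime_gt1.
have : t ^+ (p ^ n).-1 = 1.
  by apply: (mulfI t0); rewrite -exprS prednK ?mulr1 // (ltn_trans _ P1).
move/(congr1 nu); rewrite (nuX nuA) (nu1 nuA) => /eqP.
by rewrite pexpr_eq1 ?nu_ge0 -?subn1 ?subn_gt0 // => /eqP.
Qed.

Lemma teich_le1 t : teich t -> nu t <= 1.
Proof. by case/teich_norm => ->; rewrite ?(nu0 nuA) ?ler01. Qed.

Inductive wring : K -> Prop :=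
| wring_teich t : teich t -> wring t
| wringB x y : wring x -> wring y -> wring (x - y)
| wringM x y : wring x -> wring y -> wring (x * y).

Lemma wring_subring : is_subring wring.
Proof. by split; [apply/wring_teich/teich1 | exact: wringB | exact: wringM]. Qed.

Lemma wring_le1 x : wring x -> nu x <= 1.
Proof.
elim=> [t|x' y _ IHx _ IHy|x' y _ IHx _ IHy].
- exact: teich_le1.
- exact: nuB_le.
- exact: nuM_le1.
Qed.

(* Frobenius is a ring morphism modulo p, and an iterate of it fixes the
   finitely many generators involved in x. *)
Lemma wring_frob x : wring x -> exists2 n, (0 < n)%N &
  forall k, exists2 y, wring y & x ^+ (p ^ (n * k)) = x + p%:R * y.
Proof.
have sW := wring_subring; have Wp := subring_nat sW p.
elim=> [t [n n0 tn]|{}x y Wx [n n0 IHx] Wy [m m0 IHy]|{}x y Wx [n n0 IHx] Wy [m m0 IHy]].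
- exists n => // k; exists 0; first exact: subring0 sW.
  by rewrite expr_iter // mulr0 addr0.
- exists (n * m)%N => [|k]; first by rewrite muln_gt0 n0.
  have [c Wc ->] := frobB sW p_pr (n * m * k) Wx Wy.
  rewrite -{1}mulnA (mulnC n m) -mulnA.
  have [a Wa ->] := IHx (m * k)%N; have [b Wb ->] := IHy (n * k)%N.
  exists (a - b + c); last by ring.
  by apply: (subringD sW) => //; exact: wringB.
- exists (n * m)%N => [|k]; first by rewrite muln_gt0 n0.
  rewrite exprMn -{1}mulnA (mulnC n m) -mulnA.
  have [a Wa ->] := IHx (m * k)%N; have [b Wb ->] := IHy (n * k)%N.
  exists (x * b + a * y + p%:R * (a * b)); last by ring.
  by do ![apply: (subringD sW) | apply: wringM] => //; exact: wringM.
Qed.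

(** A high power [x ^+ (p ^ (n * k))] is negligible, and by [wring_frob] it is also congruent to [x]
    modulo p W. *)
Lemma wring_lt1_div x e : wring x -> nu x < 1 -> 0 < e ->
  exists2 y, wring y & nu (x - p%:R * y) <= e.
Proof.
move=> Wx x1 e0; have [n n0 xn] := wring_frob Wx.
have [N HN] := expr_small (nu_ge0 nuA x) x1 e0.
have [y Wy xE] := xn N; exists (- y); first exact: subringN wring_subring _ Wy.
rewrite mulrN opprK -xE (nuX nuA); apply: HN.
apply: leq_trans (ltnW (ltn_expl _ (prime_gt1 p_pr))).
exact: leq_pmull.
Qed.

Lemma wring_lt1_norm x : wring x -> nu x < 1 -> x != 0 ->
  exists2 y, wring y & nu x = nu p%:R * nu y.
Proof.
move=> Wx x1 x0; have nx0 : 0 < nu x by rewrite (nu_gt0 nuA).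
have [y Wy xy] := wring_lt1_div Wx x1 (divr_gt0 nx0 (ltr0n _ 2)).
exists y => //; rewrite -(nuM nuA); apply/esym/(nu_near_eq nuA).
by rewrite (nu_distC nuA); apply: le_lt_trans xy _; lra.
Qed.

Lemma wring_lt1_le x : wring x -> nu x < 1 -> nu x <= nu p%:R.
Proof.
move=> Wx x1; have [->|x0] := eqVneq x 0; first by rewrite (nu0 nuA) nu_ge0.
have [y Wy ->] := wring_lt1_norm Wx x1 x0.
by rewrite ler_piMr ?nu_ge0 ?wring_le1.
Qed.

(** [wring_lt1_norm] strips one factor [nu p%:R] at a time; an element of norm above [nu p%:R ^+ j]
    allows fewer than [j] such steps. *)
Lemma wring_norm x : wring x -> x != 0 -> exists j, nu x = nu p%:R ^+ j.
Proof.
have pi0 : 0 < nu p%:R by rewrite (nu_gt0 nuA).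
have main j : forall y, wring y -> nu p%:R ^+ j < nu y -> exists i, nu y = nu p%:R ^+ i.
  elim: j => [|j IH] y Wy yj.
    by move: yj; rewrite expr0 ltNge wring_le1.
  have y0 : y != 0.
    by rewrite -(nu_gt0 nuA); apply: le_lt_trans yj; rewrite exprn_ge0 ?nu_ge0.
  have := wring_le1 Wy; rewrite le_eqVlt => /orP[/eqP y1|y1]; first by exists 0%N.
  have [z Wz yE] := wring_lt1_norm Wy y1 y0.
  have [|i zi] := IH z Wz; first by move: yj; rewrite yE exprS ltr_pM2l.
  by exists i.+1; rewrite yE zi exprS.
move=> Wx x0; have e0 : 0 < nu x / 2 by rewrite divr_gt0 // (nu_gt0 nuA).
have [N /(_ N (leqnn N)) HN] := expr_small (nu_ge0 nuA p%:R) p_lt1 e0.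
apply: (main N) => //; apply: le_lt_trans HN _; lra.
Qed.

Definition wspan l (g : 'I_l -> K) (x : K) : Prop :=
  exists2 a : 'I_l -> K, (forall i, wring (a i)) & x = \sum_i a i * g i.

Lemma wspanB l (g : 'I_l -> K) x y : wspan g x -> wspan g y -> wspan g (x - y).
Proof.
move=> [a Wa ->] [b Wb ->]; exists (fun i => a i - b i); first by move=> i; exact: wringB.
by rewrite -sumrB; apply: eq_bigr => i _; rewrite mulrBl.
Qed.

Lemma wspanZ l (g : 'I_l -> K) c x : wring c -> wspan g x -> wspan g (c * x).
Proof.
move=> Wc [a Wa ->]; exists (fun i => c * a i); first by move=> i; exact: wringM.
by rewrite mulr_sumr; apply: eq_bigr => i _; rewrite mulrA.
Qed.

Lemma wspan_gen l (g : 'I_l -> K) i : wspan g (g i).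
Proof.
exists (fun j => (j == i)%:R); first by move=> j; exact: (subring_nat wring_subring).
by rewrite (bigD1 i) //= eqxx mul1r big1 ?addr0 // => j /negPf ->; rewrite mul0r.
Qed.

Lemma wspan0 l (g : 'I_l -> K) : wspan g 0.
Proof.
exists (fun=> 0); first by move=> i; exact: (subring0 wring_subring).
by rewrite big1 // => i _; rewrite mul0r.
Qed.

(** Elimination without division: each round removes one generator and one element, and products of
    nonzero coefficients stay nonzero in the field. *)
Lemma wspan_dependent l (g : 'I_l -> K) (x : 'I_l.+1 -> K) :
  (forall k, wspan g (x k)) -> exists a : 'I_l.+1 -> K,
    [/\ forall k, wring (a k), exists k, a k != 0 & \sum_k a k * x k = 0].
Proof.
have sW := wring_subring.
elim: l g x => [|l IH] g x gx.
  exists (fun=> 1); split=> [_||]; first exact: subring1 sW.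
    by exists ord0; rewrite oner_eq0.
  by rewrite big1 // => k _; have [a _ ->] := gx k; rewrite big_ord0 mulr0.
have [k|b bP] := @choice _ _
    (fun k a => (forall i, wring (a i)) /\ x k = \sum_i a i * g i).
  by have [a Wa E] := gx k; exists a.
(* The pivot [c] is a nonzero coefficient of the first generator if there is one; otherwise that
   generator is already absent and [c = 1] will do. *)
have [k0 [c Wc [c0 cE]]] : exists k0, exists2 c, wring c &
    c != 0 /\ (c = b k0 ord0 \/ forall k, b k ord0 = 0).
  have [[k bk]|nb] := pselect (exists k, b k ord0 != 0).
    by exists k; exists (b k ord0); [exact: (bP k).1 | split; last left].
  exists ord0; exists 1; first exact: subring1 sW.
  split; first exact: oner_neq0.
  by right=> k; apply/eqP; apply/negP => /negP bk; apply: nb; exists k.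
pose d k := b k ord0.
(* Cross-multiplication cancels the first generator, so each [y k] lies in the span of the other
   [l]. *)
pose y k := c * x (lift k0 k) - d (lift k0 k) * x k0.
have [k|a [Wa [k ak] aE]] := IH (fun i => g (lift ord0 i)) y.
  pose bb i := c * b (lift k0 k) (lift ord0 i) - d (lift k0 k) * b k0 (lift ord0 i).
  exists bb => [i|]; first by apply: wringB; apply: wringM => //; apply: (bP _).1.
  rewrite /y (bP _).2 (bP k0).2 !big_ord_recl !mulrDr opprD addrACA.
  rewrite (_ : _ - _ = 0) ?add0r.
    by rewrite !mulr_sumr -sumrB; apply: eq_bigr => i _; rewrite mulrBl !mulrA.
  rewrite /d; case: cE => [->|bz]; first by ring.
  by rewrite !bz; ring.
exists (fun j => if unlift k0 j is Some i then a i * c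
                 else - \sum_i a i * d (lift k0 i)); split.
- move=> j; case: unliftP => [i _|_]; first exact: wringM.
  apply: (subringN sW); apply: (subring_sum sW) => i _; apply: wringM => //.
  exact: (bP _).1.
- by exists (lift k0 k); rewrite liftK mulf_neq0.
rewrite (bigD1_ord k0) //= unlift_none.
under [X in _ + X]eq_bigr => i _ do rewrite liftK.
rewrite mulNr addrC mulr_suml -sumrB -[RHS]aE; apply: eq_bigr => i _.
by rewrite /y mulrBr !mulrA.
Qed.

(** In a vanishing sum two terms share the largest norm. Their coefficients have norms that are
    powers of [nu p%:R], so the norms of the two elements differ by such a power. *)
Lemma wspan_norms l (g : 'I_l -> K) (x : 'I_l.+1 -> K) :
  (forall k, wspan g (x k)) -> (forall k, x k != 0) ->
  exists i j, i != j /\ (nu (x i) = nu (x j) \/ nu (x i) <= nu p%:R * nu (x j)).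
Proof.
move=> gx x0; have [a [Wa [k0 ak0] aE]] := wspan_dependent gx.
pose f k := nu (a k * x k).
case: (arg_maxP (P := xpredT) f (i0 := k0) isT) => i _ imax.
have fi0 : 0 < f i.
  by apply: lt_le_trans (imax k0 isT); rewrite (nu_gt0 nuA) mulf_neq0.
have [j ji fj] : exists2 j, j != i & f i <= f j.
  apply: contrapT => nj.
  have : nu (\sum_(j | j != i) a j * x j) < f i.
    apply: (nu_sum_lt nuA) => // j ji; rewrite ltNge; apply/negP => ij.
    by apply: nj; exists j.
  move/eqP: aE; rewrite (bigD1 i) //= addrC addr_eq0 => /eqP ->.
  by rewrite (nuN nuA) ltxx.
have fE : f i = f j by apply/eqP; rewrite eq_le fj; exact: imax.
have a_nz k : 0 < f k -> a k != 0.
  by rewrite (nu_gt0 nuA); apply: contra_neq => ->; rewrite mul0r.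
have [m aiE] := wring_norm (Wa i) (a_nz i fi0).
have [n ajE] := wring_norm (Wa j) (a_nz j (lt_le_trans fi0 fj)).
have pi0 : 0 < nu p%:R by rewrite (nu_gt0 nuA).
move: fE; rewrite /f !(nuM nuA) aiE ajE.
wlog mn : i j m n ji {imax fi0 fj aiE ajE} / (m <= n)%N.
  move=> W E; have [mn|/ltnW nm] := leqP m n; first exact: (W i j m n).
  by apply: (W j i n m) => //; rewrite eq_sym.
rewrite -(subnK mn) addnC exprD -mulrA => E.
exists i, j; split; first by rewrite eq_sym.
have {E} -> : nu (x i) = nu p%:R ^+ (n - m) * nu (x j).
  by apply: mulfI E; rewrite expf_neq0 // gt_eqF.
case: (n - m)%N => [|d]; first by left; rewrite expr0 mul1r.
right; rewrite exprS -mulrA ler_wpM2l ?nu_ge0 // ler_piMl ?nu_ge0 //.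
by rewrite exprn_ile1 ?nu_ge0 // ltW.
Qed.

(* By [wspan_norms] the norms of a finitely generated W-module meet finitely
   many cosets of the powers of |p|, so those above [eps] are well-founded. *)
Lemma wspan_norm_ind l (g : 'I_l -> K) (eps : R) (P : R -> Prop) : 0 < eps ->
  (forall x, wspan g x ->
    (forall y, wspan g y -> eps < nu y -> nu y < nu x -> P (nu y)) -> P (nu x)) ->
  forall x, wspan g x -> P (nu x).
Proof.
move=> e0 HP; have pi0 : 0 < nu p%:R by rewrite (nu_gt0 nuA).
(* Induction on the number of factors [nu p%:R] needed to bring [nu x] down to [eps]. *)
have main j : forall x, wspan g x -> nu x * nu p%:R ^+ j <= eps -> P (nu x).
  elim: j => [|j IH].
    move=> x gx; rewrite expr0 mulr1 => xe; apply: HP => // y _ ey yx.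
    by have := lt_le_trans (lt_trans ey yx) xe; rewrite ltxx.
  (* [h] lists elements of distinct norms above [nu x], all in the band from [eps / nu p%:R ^+ j]
     (excluded) to [eps / nu p%:R ^+ j.+1]. This band is too narrow for a ratio [nu p%:R], so by
     [wspan_norms] it contains at most [l] norms; [i] counts the room left. *)
  have chain i : forall (h : seq K) x, (size h + i = l.+1)%N -> uniq (map nu h) ->
      (forall y, y \in h -> [/\ wspan g y, eps < nu y * nu p%:R ^+ j,
         nu y * nu p%:R ^+ j.+1 <= eps & nu x < nu y]) ->
      wspan g x -> nu x * nu p%:R ^+ j.+1 <= eps -> P (nu x).
    elim: i => [|i IHi] h x; rewrite ?addn0 => sh uh hP gx xe.
      have hx k : (k < l.+1)%N -> h`_k \in h by rewrite -sh; exact: mem_nth.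
      have [k|k|i1 [i2 [i12 D]]] := @wspan_norms l g (fun k => h`_k).
      - by have [] := hP _ (hx k (ltn_ord k)).
      - have [_ ek _ _] := hP _ (hx k (ltn_ord k)).
        have := lt_trans e0 ek; rewrite pmulr_lgt0 ?exprn_gt0 //.
        by rewrite (nu_gt0 nuA).
      have [_ e1 e1' _] := hP _ (hx i1 (ltn_ord i1)).
      have [_ e2 e2' _] := hP _ (hx i2 (ltn_ord i2)).
      case: D => [E|le12].
        have := uh; move/uniqP => /(_ 0 i1 i2); rewrite !inE size_map sh !ltn_ord.
        rewrite !(nth_map 0) ?sh // => /(_ isT isT E) /ord_inj /eqP.
        by rewrite (negPf i12).
      have : nu h`_i1 * nu p%:R ^+ j <= eps.
        apply: le_trans e2'; rewrite exprS mulrA (mulrC (nu h`_i2)).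
        by rewrite ler_wpM2r // exprn_ge0 // nu_ge0.
      by rewrite leNgt e1.
    have [xj|xj] := leP (nu x * nu p%:R ^+ j) eps; first exact: IH.
    apply: HP => // y gy ey yx.
    apply: (IHi (x :: h)) => //.
    - by rewrite /= addSnnS.
    - rewrite /= uh andbT; apply/mapP => -[z /hP[_ _ _ xz] E].
      by rewrite E ltxx in xz.
    - move=> z; rewrite inE => /predU1P[->//|/hP[? ? ? xz]]; split=> //.
      exact: lt_trans xz.
    by apply: le_trans xe; rewrite ler_wpM2r ?exprn_ge0 ?nu_ge0 // ltW.
  by move=> x gx xe; apply: (chain l.+1 [::] x).
move=> x gx; have [/eqP x0|xn0] := eqVneq (nu x) 0.
  by apply: (main 0%N); rewrite // (eqP x0) mul0r ltW.
have x0 : 0 < nu x by rewrite lt_def xn0 nu_ge0.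
have [N /(_ N (leqnn N)) HN] := expr_small (nu_ge0 nuA p%:R) p_lt1 (divr_gt0 e0 x0).
by apply: (main N) => //; rewrite mulrC -ler_pdivlMr.
Qed.

End Teichmueller.

(** * Maxima over lists, integral polynomials and their Frobenius twists *)

Lemma seq_argmax d (O : orderType d) (T : eqType) (s : seq T) (F : T -> O) x :
  x \in s -> exists2 y, y \in s & forall z, z \in s -> (F z <= F y)%O.
Proof.
elim: s x => // a [|b s] IH x _.
  by exists a => [|z]; rewrite inE // => /eqP ->.
have [y ys ymax] := IH b (mem_head _ _).
have [ay|ya] := Order.TotalTheory.leP (F a) (F y).
  exists y => [|z]; first by rewrite inE ys orbT.
  by rewrite inE => /predU1P[->|/ymax].
exists a => [|z]; first exact: mem_head.
by rewrite inE => /predU1P[->//|/ymax /le_trans]; apply; exact: ltW.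
Qed.

Section IntegralPolynomials.
Variables (R : realType) (K : fieldType) (nu : K -> R).
Hypothesis nuA : ultrametric_abs nu.
Variable n : nat.
Implicit Types (f g : {mpoly K[n]}) (v : 'I_n -> K).

Definition integral f : Prop := forall m, nu f@_m <= 1.

Lemma monom_le1 v (m : 'X_{1..n}) : (forall i, nu (v i) <= 1) ->
  nu (\prod_i v i ^+ m i) <= 1.
Proof. by move=> v1; apply: (nu_prod_le1 nuA) => i; apply: (nuX_le1 nuA). Qed.

Lemma meval_le f v c : 0 <= c -> (forall i, nu (v i) <= 1) ->
  (forall m, nu f@_m <= c) -> nu f.@[v] <= c.
Proof.
move=> c0 v1 fc; rewrite mevalE; apply: (nu_sum_le nuA) => // m _.
rewrite (nuM nuA); apply: le_trans (fc m).
by rewrite ler_piMr ?nu_ge0 ?monom_le1.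
Qed.

Lemma meval_lt f v c : 0 < c -> (forall i, nu (v i) <= 1) ->
  (forall m, nu f@_m < c) -> nu f.@[v] < c.
Proof.
move=> c0 v1 fc; rewrite mevalE; apply: (nu_sum_lt nuA) => // m _.
rewrite (nuM nuA); apply: le_lt_trans (fc m).
by rewrite ler_piMr ?nu_ge0 ?monom_le1.
Qed.

Lemma meval_dist_le f v w c : integral f ->
  (forall i, nu (v i) <= 1) -> (forall i, nu (w i) <= 1) ->
  0 <= c -> (forall i, nu (v i - w i) <= c) -> nu (f.@[v] - f.@[w]) <= c.
Proof.
move=> f1 v1 w1 c0 vw; rewrite !mevalE -sumrB; apply: (nu_sum_le nuA) => // m _.
rewrite -mulrBr (nuM nuA).
apply: le_trans (_ : nu (\prod_i v i ^+ m i - \prod_i w i ^+ m i) <= c).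
  by rewrite ler_piMl ?nu_ge0.
suff [] : [/\ nu (\prod_i v i ^+ m i) <= 1, nu (\prod_i w i ^+ m i) <= 1 &
    nu (\prod_i v i ^+ m i - \prod_i w i ^+ m i) <= c] by [].
elim/big_ind2: _ => [|a1 a2 b1 b2 [Ha1 Ha2 Ha] [Hb1 Hb2 Hb]|i _].
- by rewrite subrr (nu0 nuA) (nu1 nuA).
- split; rewrite ?(nuM_le1 nuA) //.
  have -> : a2 * b2 - a1 * b1 = (a2 - a1) * b1 + a2 * (b2 - b1) by ring.
  apply: (nuD_le nuA); rewrite (nuM nuA).
    by apply: le_trans Ha; rewrite ler_piMr ?nu_ge0.
  by apply: le_trans Hb; rewrite ler_piMl ?nu_ge0.
split; rewrite ?(nuX_le1 nuA) //; apply: le_trans (vw i).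
exact: (distX_le nuA).
Qed.

Lemma max_mcoeff f : f != 0 -> exists2 m, f@_m != 0 & forall k, nu f@_k <= nu f@_m.
Proof.
rewrite -msupp_eq0; case E: (msupp f) => [//|m0 s] _.
have [|m ms mmax] := @seq_argmax _ R _ (msupp f) (fun m => nu f@_m) m0.
  by rewrite E mem_head.
exists m => [|k]; first by rewrite -mcoeff_msupp.
have [/mmax //|/memN_msupp_eq0 ->] := boolP (k \in msupp f).
by rewrite (nu0 nuA) nu_ge0.
Qed.

Lemma mpoly_subring (S : K -> Prop) : is_subring S ->
  is_subring (fun f => forall m, S f@_m).
Proof.
move=> sS; split=> [m|f g Sf Sg m|f g Sf Sg m].
- by rewrite mcoeff1; exact: (subring_nat sS).
- by rewrite mcoeffB; exact: (subringB sS).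
- by rewrite mcoeffM; apply: (subring_sum sS) => k _; exact: (subringM sS).
Qed.

Lemma mcoeff_sumX (T : Type) (s : seq T) (c : T -> K) (h : T -> 'X_{1..n}) k :
  (\sum_(m <- s) c m *: 'X_[h m])@_k = \sum_(m <- s) c m * (h m == k)%:R.
Proof.
rewrite (raddf_sum (mcoeff k)) /=; apply: eq_bigr => m _.
by rewrite mcoeffZ mcoeffX.
Qed.

Lemma meval_sumX (T : Type) (s : seq T) (c : T -> K) (h : T -> 'X_{1..n}) v :
  (\sum_(m <- s) c m *: 'X_[h m]).@[v] = \sum_(m <- s) c m * \prod_i v i ^+ h m i.
Proof.
rewrite (raddf_sum (meval v)) /=; apply: eq_bigr => m _.
by rewrite mevalZ mevalX.
Qed.

Variable p : nat.
Hypotheses (p_pr : prime p) (p_lt1 : nu p%:R < 1).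

(** The Frobenius twist of [f]: modulo the maximal ideal its value at the [p ^ r]-th powers of [v]
    is the [p ^ r]-th power of [f.@[v]]. It moves vanishing conditions between a point and its
    powers. *)
Definition coef_frob r f : {mpoly K[n]} :=
  \sum_(m <- msupp f) f@_m ^+ (p ^ r) *: 'X_[m].

Lemma coef_frob_integral r f : integral f -> integral (coef_frob r f).
Proof.
move=> f1 k; rewrite mcoeff_sumX; apply: (nu_sum_le nuA) => // m _.
by apply: (nuM_le1 nuA); [exact: (nuX_le1 nuA) | exact: (nu_nat_le1 nuA)].
Qed.

Lemma meval_coef_frob r f v : integral f -> (forall i, nu (v i) <= 1) ->
  nu ((coef_frob r f).@[fun i => v i ^+ (p ^ r)] - f.@[v] ^+ (p ^ r)) < 1.
Proof.
move=> f1 v1; rewrite meval_sumX mevalE.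
have [|c c1 ->] := @frob_sum _ _ (subring_int nuA) _ p_pr r _ (msupp f)
    (fun m => f@_m * \prod_i v i ^+ m i).
  by move=> m; apply: (nuM_le1 nuA) => //; exact: monom_le1.
rewrite [X in X - _](_ : _ = \sum_(i <- msupp f) (f@_i * \prod_j v j ^+ i j) ^+ (p ^ r)).
  rewrite opprD addNKr (nuN nuA) (nuM nuA); apply: le_lt_trans p_lt1.
  by rewrite ler_piMr ?nu_ge0.
apply: eq_bigr => m _; rewrite exprMn -prodrXl; congr (_ * _).
by apply: eq_bigr => i _; rewrite exprAC.
Qed.

Lemma meval_coef_frob_lt1 r f v : integral f -> (forall i, nu (v i) <= 1) ->
  (nu (coef_frob r f).@[fun i => v i ^+ (p ^ r)] < 1) = (nu f.@[v] < 1).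
Proof.
move=> f1 v1; have near := meval_coef_frob r f1 v1.
rewrite -(nuX_lt1 nuA f.@[v] (n := (p ^ r)%N)) ?expn_gt0 ?prime_gt0 //.
apply/idP/idP; last exact: (nu_near_lt nuA near).
by apply: (nu_near_lt nuA); rewrite (nu_distC nuA).
Qed.

End IntegralPolynomials.

(** * Sublevel sets of polynomials on Teichmueller points *)

Section TeichmuellerEvaluation.
Variables (R : realType) (K : fieldType) (nu : K -> R).
Hypothesis nuA : ultrametric_abs nu.
Variable p : nat.
Hypotheses (p_pr : prime p) (p_lt1 : nu p%:R < 1) (p_nz : p%:R != 0 :> K).
Hypothesis teich_lift : forall y, nu y <= 1 -> exists2 t, teich p t & nu (y - t) < 1.
Variable n : nat.

(* [b *: B ^+ p ^ r] cancels [G('X ^ p ^ r)] modulo terms smaller than [b],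
   while leaving the coefficients in the same W-module, because [B ^+ p ^ r] is
   congruent to [\sum_m t m *: 'X^(p ^ r * m)] modulo p.  On Teichmueller points
   where [G / b] is not a unit, [B] is divisible by p, so that its power is
   negligible. *)
Lemma teich_reduce (G : {mpoly K[n]}) (M : K -> Prop) (eps : R) m0 :
  0 < eps ->
  (forall x y, M x -> M y -> M (x - y)) ->
  (forall c x, wring p c -> M x -> M (c * x)) ->
  (forall m, M G@_m) -> (forall m, nu G@_m <= nu G@_m0) -> G@_m0 != 0 ->
  exists r (G1 : {mpoly K[n]}), [/\ forall m, M G1@_m, forall m, nu G1@_m < nu G@_m0 &
    forall v, (forall i, teich p (v i)) ->
      nu G.@[fun i => v i ^+ (p ^ r)] < nu G@_m0 ->
      nu (G1.@[v] - G.@[fun i => v i ^+ (p ^ r)]) <= eps].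
Proof.
set b := G@_m0 => e0 MB MZ MG Gb b0; have nb0 : 0 < nu b by rewrite (nu_gt0 nuA).
have sW := wring_subring K p; have Mb : M b by exact: MG.
have M0 : M 0 by rewrite -(subrr b); exact: (MB).
have MD x y : M x -> M y -> M (x + y).
  by move=> Mx My; rewrite -[y]opprK -[- y]sub0r; apply: (MB) => //; exact: (MB).
(* [t m] represents the residue of [G@_m / b], which is integral because [b] has the largest
   norm. *)
have [t tP] : {t : 'X_{1..n} -> K & forall m, teich p (t m) /\ nu (G@_m - b * t m) < nu b}.
  apply: (choice (P := fun m t => teich p t /\ nu (G@_m - b * t) < nu b)) => m.
  have [|t tT Gt] := @teich_lift (b^-1 * G@_m).
    by rewrite (nuM nuA) (nuV nuA) mulrC ler_pdivrMr // mul1r.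
  exists t; split=> //; rewrite -[G@_m](mulKf b0) mulrCA -mulrBr (nuM nuA).
  by rewrite gtr_pMr.
(* This bounds the term [b * B.@[v] ^+ P] below once [B.@[v]] is known to have norm at most
   [nu p%:R]. *)
have [r rP] : exists r, nu b * nu p%:R ^+ (p ^ r) <= eps.
  have [N HN] := expr_small (nu_ge0 nuA p%:R) p_lt1 (divr_gt0 e0 nb0).
  exists N; rewrite mulrC -ler_pdivlMr //; apply: HN.
  exact: ltnW (ltn_expl _ (prime_gt1 p_pr)).
have [t' t'T t'E] := teich_roots r (fun m => (tP m).1).
set P := (p ^ r)%N in rP t'E *; set s := msupp G.
pose B : {mpoly K[n]} := \sum_(m <- s) t' m *: 'X_[m].
have [|C WC BE] := @frob_sum _ _ (mpoly_subring n sW) _ p_pr r _ s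
    (fun m => t' m *: 'X_[m]).
  move=> m k; rewrite mcoeffZ mcoeffX; apply: (subringM sW).
    by apply: wring_teich; exact: t'T.
  exact: (subring_nat sW).
have {BE} BE : B ^+ P = \sum_(m <- s) t m *: 'X_[(m *+ P)%MM] + p%:R * C.
  rewrite BE; congr (_ + _); apply: eq_bigr => m _.
  by rewrite exprZn t'E mpolyXn.
pose G1 := \sum_(m <- s) G@_m *: 'X_[(m *+ P)%MM] - b *: B ^+ P.
(* In this form the coefficients are visibly smaller than [b] and visibly in [M]. *)
have G1E : G1 = \sum_(m <- s) (G@_m - b * t m) *: 'X_[(m *+ P)%MM] - b *: (p%:R * C).
  rewrite /G1 BE scalerDr opprD addrA; congr (_ - _).
  rewrite scaler_sumr -sumrB; apply: eq_bigr => m _.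
  by rewrite scalerA scalerBl.
have G1b k : nu G1@_k < nu b.
  rewrite G1E mcoeffB mcoeffZ mulr_natl mcoeffMn mcoeff_sumX.
  apply: (nuB_lt nuA).
    apply: (nu_sum_lt nuA) => // m _; rewrite (nuM nuA).
    apply: le_lt_trans (tP m).2; rewrite ler_piMr ?nu_ge0 ?(nu_nat_le1 nuA) //.
  rewrite -mulr_natl (nuM nuA) gtr_pMr // (nuM nuA); apply: le_lt_trans p_lt1.
  by rewrite ler_piMr ?nu_ge0 // (wring_le1 nuA p_pr).
have XP v m : \prod_i v i ^+ (m *+ P)%MM i = \prod_i (v i ^+ P) ^+ m i :> K.
  by apply: eq_bigr => i _; rewrite mulmnE mulnC exprM.
exists r, G1; split.
- move=> k; rewrite G1E mcoeffB mcoeffZ mulr_natl mcoeffMn mcoeff_sumX; apply: (MB).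
    apply: (big_ind M M0 MD) => m _.
    rewrite mulrC; apply: (MZ); first exact: (subring_nat sW).
    apply: (MB) => //; rewrite mulrC; apply: (MZ) => //.
    by apply: wring_teich; exact: (tP m).1.
  by rewrite mulrC; apply: (MZ) => //; apply: (subringMn sW).
- by [].
move=> v vT Gv.
have v1 i : nu (v i) <= 1 by apply: (teich_le1 nuA p_pr).
have vP1 i : nu (v i ^+ P) <= 1 by apply: (nuX_le1 nuA).
have BvW : wring p B.@[v].
  rewrite meval_sumX; apply: (subring_sum sW) => m _; apply: (subringM sW).
    by apply: wring_teich; exact: t'T.
  elim/big_ind: _ => [|x y|i _]; [exact: (subring1 sW) | exact: (subringM sW) |].
  by apply: (subringX sW); apply: wring_teich.
have G1v : G1.@[v] = G.@[fun i => v i ^+ P] - b * B.@[v] ^+ P.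
  rewrite mevalB mevalZ rmorphXn /=; congr (_ - _); rewrite meval_sumX mevalE.
  by apply: eq_bigr => m _; rewrite XP.
(* Both [G] at the powers of [v] and [G1] at [v] are smaller than [b], hence so is their difference
   [b * B.@[v] ^+ P]. *)
have Bv1 : nu B.@[v] < 1.
  rewrite -(nuX_lt1 nuA _ (n := P)) ?expn_gt0 ?prime_gt0 //.
  suff : nu (b * B.@[v] ^+ P) < nu b by rewrite (nuM nuA) gtr_pMr.
  have -> : b * B.@[v] ^+ P = G.@[fun i => v i ^+ P] - G1.@[v] by rewrite G1v; ring.
  by apply: (nuB_lt nuA) => //; exact: (meval_lt nuA).
rewrite G1v addrC addKr (nuN nuA) (nuM nuA) (nuX nuA); apply: le_trans rP.
rewrite ler_wpM2l ?nu_ge0 //; apply: lerXn2r; rewrite ?nnegrE ?nu_ge0 //.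
exact: (wring_lt1_le nuA p_pr).
Qed.

(** Descent on the Gauss norm of [G]: if [w] attains it, [G] divided by its largest coefficient
    separates [w] from the sublevel set; otherwise [teich_reduce] passes to a polynomial of smaller
    norm at the [p ^ r]-th roots of the points. *)
Lemma teich_sublevel_closed (G : {mpoly K[n]}) (eps : R) (w : 'I_n -> K) :
  0 < eps -> (forall i, teich p (w i)) -> eps < nu G.@[w] ->
  exists f : {mpoly K[n]}, [/\ integral nu f, nu f.@[w] = 1 &
    forall u, (forall i, teich p (u i)) -> nu G.@[u] <= eps -> nu f.@[u] < 1].
Proof.
move=> e0; have [l [gen genG]] : exists l (gen : 'I_l -> K), forall m, wspan p gen G@_m.
  exists (size (msupp G)), (fun i => G@_(nth 0%MM (msupp G) i)) => m.
  have [mG|/memN_msupp_eq0 ->] := boolP (m \in msupp G); last exact: wspan0.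
  have im : (index m (msupp G) < size (msupp G))%N by rewrite index_mem.
  have := wspan_gen p (fun i : 'I_(size (msupp G)) => G@_(nth 0%MM (msupp G) i)) (Ordinal im).
  by rewrite /= nth_index.
(* The descent changes both the polynomial and the point, so [P] quantifies over both; [gen] stays
   fixed. *)
pose P c := forall (G : {mpoly K[n]}) m0, (forall m, wspan p gen G@_m) ->
  (forall m, nu G@_m <= nu G@_m0) -> nu G@_m0 = c -> forall w, (forall i, teich p (w i)) ->
  eps < nu G.@[w] -> exists f : {mpoly K[n]}, [/\ integral nu f, nu f.@[w] = 1 &
    forall u, (forall i, teich p (u i)) -> nu G.@[u] <= eps -> nu f.@[u] < 1].
have T1 u : (forall i : 'I_n, teich p (u i)) -> forall i, nu (u i) <= 1.
  by move=> uT i; apply: (teich_le1 nuA p_pr).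
have main : forall x, wspan p gen x -> P (nu x).
  apply: (wspan_norm_ind nuA p_pr p_lt1 p_nz e0) => x gx IH {genG}G m0 gG Gmax Gx {}w wT Gw.
  have Gwx : nu G.@[w] <= nu G@_m0.
    by apply: (meval_le nuA) => //; [exact: nu_ge0 | exact: T1].
  have eb := lt_le_trans Gw Gwx; have nb0 := lt_trans e0 eb.
  have b0 : G@_m0 != 0 by rewrite -(nu_gt0 nuA).
  have G1E v : nu ((G@_m0)^-1 *: G).@[v] = nu G.@[v] / nu G@_m0.
    by rewrite mevalZ (nuM nuA) (nuV nuA) mulrC.
  move: Gwx; rewrite le_eqVlt => /orP[/eqP Gwx|Gwx].
    exists ((G@_m0)^-1 *: G); split=> [m||u uT Gu].
    - by rewrite mcoeffZ (nuM nuA) (nuV nuA) mulrC ler_pdivrMr // mul1r.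
    - by rewrite G1E Gwx divff // gt_eqF.
    by rewrite G1E ltr_pdivrMr // mul1r; exact: le_lt_trans eb.
  have [r [G1 [gG1 G1b G1v]]] := teich_reduce e0 (@wspanB _ _ _ gen)
    (@wspanZ _ _ _ gen) gG Gmax b0.
  have [w' w'T w'E] := teich_roots r wT.
  have near := G1v _ w'T; rewrite (meval_eq _ w'E) in near.
  have G1w : eps < nu G1.@[w'].
    rewrite ltNge; apply/negP => le; move: Gw; rewrite ltNge => /negP; apply.
    by apply: (nu_near_le nuA) le; rewrite (nu_distC nuA); exact: near.
  have G1nz : G1 != 0.
    by apply: contraTneq G1w => ->; rewrite meval0 (nu0 nuA) -leNgt ltW.
  have [k _ G1max] := max_mcoeff nuA G1nz.
  have ek : eps < nu G1@_k.
    apply: lt_le_trans G1w _; apply: (meval_le nuA) => //; [exact: nu_ge0 | exact: T1].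
  have kx : nu G1@_k < nu x by rewrite -Gx.
  have [f [f1 fw fu]] := IH _ (gG1 k) ek kx G1 k gG1 G1max erefl w' w'T G1w.
  (* [f] separates at the roots [w'] and [u']; its twist does so at [w] and [u]. *)
  exists (coef_frob p r f); split.
  - exact: coef_frob_integral.
  - apply/eqP; rewrite eq_le; apply/andP; split.
      by apply: (meval_le nuA) => //; [exact: T1 | exact: coef_frob_integral].
    rewrite -(meval_eq _ w'E) leNgt (meval_coef_frob_lt1 nuA p_pr p_lt1) ?fw ?ltxx //.
    exact: T1.
  move=> u uT Gu.
  have [u' u'T u'E] := teich_roots r uT.
  rewrite -(meval_eq _ u'E) (meval_coef_frob_lt1 nuA p_pr p_lt1) //; last exact: T1.
  apply: fu => //; apply: (nu_near_le nuA) (Gu); rewrite -(meval_eq _ u'E).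
  apply: G1v => //; rewrite (meval_eq _ u'E).
  exact: le_lt_trans eb.
move=> wT Gw; have Gnz : G != 0.
  by apply: contraTneq Gw => ->; rewrite meval0 (nu0 nuA) -leNgt ltW.
have [m0 _ Gmax] := max_mcoeff nuA Gnz.
exact: (main _ (genG m0) G m0).
Qed.

End TeichmuellerEvaluation.

(** * Dickson's lemma and Noetherianity over the residue field *)

(** Let [s] serve the first [k] coordinates. It still serves every [m] whose next coordinate is at
    least the maximum over [s]; below that maximum the coordinate takes finitely many values, each
    served by its own list [S v]. *)
Lemma dickson_coord (T : eqType) (c : nat -> T -> nat) k (U : T -> Prop) :
  exists s : seq T, (forall a, a \in s -> U a) /\
    forall m, U m -> exists2 a, a \in s & forall i, (i < k)%N -> (c i a <= c i m)%N.
Proof.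
elim: k U => [|k IH] U.
  have [[m Um]|nU] := pselect (exists m, U m).
    exists [:: m]; split=> [a|m' _]; first by rewrite inE => /eqP ->.
    by exists m; rewrite ?mem_head.
  by exists [::]; split=> // m Um; case: nU; exists m.
have [s [sU sP]] := IH U.
have [S SP] := choice (fun v => IH (fun m => U m /\ c k m = v)).
exists (s ++ flatten [seq S v | v <- iota 0 (\max_(a <- s) c k a)]); split.
  move=> a; rewrite mem_cat => /orP[/sU //|/flattenP[_ /mapP[v _ ->]]].
  by move/(SP v).1 => [].
move=> m Um; have [ge|lt] := leqP (\max_(a <- s) c k a) (c k m).
  have [a sa am] := sP m Um; exists a; first by rewrite mem_cat sa.
  move=> i; rewrite ltnS leq_eqVlt => /predU1P[->|/am //].
  by apply: leq_trans ge; exact: leq_bigmax_seq.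
have [a Sa am] := (SP (c k m)).2 m (conj Um erefl).
exists a.
  rewrite mem_cat; apply/orP; right; apply/flattenP; exists (S (c k m)) => //.
  by apply: map_f; rewrite mem_iota.
move=> i; rewrite ltnS leq_eqVlt => /predU1P[->|/am //].
by have [_ ->] := (SP (c k m)).1 a Sa.
Qed.

Lemma dickson n (U : 'X_{1..n} -> Prop) :
  exists s : seq 'X_{1..n}, (forall a, a \in s -> U a) /\
    forall m, U m -> exists2 a, a \in s & (a <= m)%MM.
Proof.
pose c i (m : 'X_{1..n}) := if insub i is Some j then m j else 0%N.
have [s [sU sP]] := dickson_coord c n U; exists s; split=> // m /sP[a sa am].
exists a => //; apply/mnm_lepP => i; have := am i (ltn_ord i).
by rewrite /c valK.
Qed.

Section Noetherian.
Variables (R : realType) (K : fieldType) (nu : K -> R).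
Hypothesis nuA : ultrametric_abs nu.
Variable n : nat.
Implicit Types f g h : {mpoly K[n]}.

(* [m] is the leading monomial of the reduction of [f]. *)
Definition red_lead f (m : 'X_{1..n}) : Prop :=
  nu f@_m = 1 /\ forall k, (m < k)%O -> nu f@_k < 1.

Lemma red_leadP f : integral nu f ->
  (forall m, nu f@_m < 1) \/ exists m, red_lead f m.
Proof.
move=> f1; have [small|/existsNP[m0 /negP]] := pselect (forall m, nu f@_m < 1).
  by left.
rewrite -leNgt => m0P; right.
have norm1 m : 1 <= nu f@_m -> m \in [seq m <- msupp f | 1 <= nu f@_m].
  move=> m1; rewrite mem_filter m1 mcoeff_msupp -(nu_gt0 nuA).
  exact: lt_le_trans m1.
have [m] := seq_argmax id (norm1 _ m0P).
rewrite mem_filter => /andP[m1 _] mmax; exists m; split.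
  by apply/eqP; rewrite eq_le m1 f1.
move=> k mk; rewrite ltNge; apply/negP => /norm1 /mmax.
by rewrite /= Order.TotalTheory.leNgt mk.
Qed.

(* Hilbert's basis theorem for polynomials over the residue field, phrased with
   ideals of integral polynomials containing those that reduce to zero. *)
Lemma noetherian_mod (I : nat -> {mpoly K[n]} -> Prop) :
  (forall i j f, (i <= j)%N -> I i f -> I j f) ->
  (forall i f g, I i f -> I i g -> I i (f - g)) ->
  (forall i h f, integral nu h -> I i f -> I i (h * f)) ->
  (forall i f, (forall m, nu f@_m < 1) -> I i f) ->
  exists i, forall j f, integral nu f -> I j f -> I i f.
Proof.
move=> Imono IB IM Ismall.
(* Minimal leading monomials of the union of all the ideals. *)
have [s [sU sP]] := dickson (fun m => exists i f, [/\ integral nu f, I i f & red_lead f m]).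
(* There are finitely many of them, so one index realises them all. *)
have [i iP] : exists i, forall a, a \in s ->
    exists f, [/\ integral nu f, I i f & red_lead f a].
  elim: s sU {sP} => [|a s IH] sU; first by exists 0%N.
  have [b bs|i iP] := IH; first by apply: sU; rewrite inE bs orbT.
  have [j [f [f1 If fa]]] := sU a (mem_head _ _).
  exists (maxn i j) => b; rewrite inE => /predU1P[->|/iP[g [g1 Ig gb]]].
    by exists f; split=> //; apply: (Imono) If; rewrite leq_maxr.
  by exists g; split=> //; apply: (Imono) Ig; rewrite leq_maxl.
exists i.
have lead m : forall j f, integral nu f -> I j f -> red_lead f m -> I i f.
  elim/(well_founded_ind (@ltom_wf n)): m => m IH j f f1 If fm.
  have [|a /iP[g [g1 Ig [ga gsmall]]] am] := sP m; first by exists j, f.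
  have ga0 : g@_a != 0 by rewrite -(nu_gt0 nuA) ga.
  (* This multiplier gives [h * g] the same coefficient as [f] at [m], so that [f - h * g] reduces
     to zero or has a smaller leading monomial. *)
  pose h := (f@_m / g@_a) *: 'X_[m - a] : {mpoly K[n]}.
  have nuc : nu (f@_m / g@_a) = 1 by rewrite (nuM nuA) (nuV nuA) ga fm.1 divr1.
  have h1 : integral nu h.
    move=> k; rewrite mcoeffZ mcoeffX (nuM nuA) nuc mul1r; exact: (nu_nat_le1 nuA).
  have hgE : h * g = (f@_m / g@_a) *: (g * 'X_[m - a]) by rewrite /h -scalerAl (mulrC g).
  have hgm : (h * g)@_m = f@_m.
    by rewrite hgE mcoeffZ -{2}(submK am) mcoeffMX mulfVK.
  have hgk k : (m < k)%O -> nu (h * g)@_k < 1.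
    move=> mk; rewrite hgE mcoeffZ (nuM nuA) nuc mul1r {1}(mpolyE g) mulr_suml.
    under eq_bigr do rewrite -scalerAl -mpolyXD.
    rewrite mcoeff_sumX; apply: (nu_sum_lt nuA) => // b _.
    have [bk|_] := eqVneq; last by rewrite mulr0 (nu0 nuA).
    rewrite mulr1; apply: gsmall; rewrite -(ltmc_add2l _ _ (m - a)%MM) bk addmC.
    by rewrite submK.
  have fhg1 : integral nu (f - h * g).
    have sI := mpoly_subring n (subring_int nuA).
    by apply: (subringB sI) => //; exact: (subringM sI).
  have Ihg : I i (h * g) by apply: IM.
  rewrite -(subrK (h * g) f) -[X in _ + X]opprK -[X in _ - X]sub0r.
  have I0 : I i 0 by apply: (Ismall) => k; rewrite mcoeff0 (nu0 nuA).
  apply: (IB); last by apply: (IB) => //; exact: Ihg.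
  have [small|[k [k1 kP]]] := red_leadP fhg1; first exact: Ismall.
  (* [f] and [h * g] lie in ideals of different index; their difference is only known to lie in the
     larger one. *)
  apply: (IH k _ (maxn i j)) => //; last first.
    by apply: (IB); [apply: (Imono) If; rewrite leq_maxr
                  | apply: (Imono) (Ihg); rewrite leq_maxl].
  rewrite Order.TotalTheory.ltNge; apply/negP.
  rewrite Order.POrderTheory.le_eqVlt => /predU1P[mk|mk].
    by move: k1; rewrite -mk mcoeffB hgm subrr (nu0 nuA) => /eqP; rewrite eq_sym oner_eq0.
  have := nuB_lt nuA (fm.2 _ mk) (hgk _ mk).
  by rewrite -mcoeffB k1 ltxx.
move=> j f f1 If; have [|[m fm]] := red_leadP f1; first exact: Ismall.
exact: (lead m j f).
Qed.

End Noetherian.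

(** * Normalised homogeneous coordinates *)

Section Coordinates.
Variables (R : realType) (K : fieldType) (nu : K -> R).
Hypothesis nuA : ultrametric_abs nu.

Lemma lt1_bound n (a : 'I_n -> K) : (forall i, nu (a i) < 1) ->
  exists2 c, 0 <= c < 1 & forall i, nu (a i) <= c.
Proof.
move=> a1; exists (\big[Num.max/0]_i nu (a i)); last by move=> i; exact: le_bigmax.
apply/andP; split; first exact: bigmax_ge_id.
by apply: bigmax_lt.
Qed.

Variables (N : nat).
Implicit Types (x : proj_space K N) (y : 'rV[K]_N.+1).

Definition unit_coords x y : Prop :=
  [/\ hcoords y x, forall i, nu (y 0 i) <= 1 & exists i, nu (y 0 i) = 1].

Lemma unit_coordsZ x y c : nu c = 1 -> unit_coords x y -> unit_coords x (c *: y).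
Proof.
move=> c1 [yx y1 [i yi]]; split.
- by apply: hcoordsZ => //; rewrite -(nu_gt0 nuA) c1.
- by move=> j; rewrite mxE (nuM nuA) c1 mul1r.
by exists i; rewrite mxE (nuM nuA) c1 mul1r.
Qed.

Lemma unit_coords_sup x y : unit_coords x y -> sup_norm nu y = 1.
Proof.
move=> [_ y1 [i yi]]; apply/eqP; rewrite eq_le; apply/andP; split.
  by apply: bigmax_le.
by rewrite -yi; exact: le_bigmax.
Qed.

(** A coordinate equal to 1, and not merely of norm 1, lets a scalar multiple of [y] reveal its
    scalar in one entry. *)
Lemma unit_coords_ex1 x : exists y, unit_coords x y /\ exists i, y 0 i = 1.
Proof.
have [zx z1] := norm_coordsP x nuA; set z := norm_coords nu x in zx z1.
have [i _ imax] := seq_argmax (fun i => nu (z 0 i)) (mem_index_enum ord0).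
have zi : nu (z 0 i) = 1.
  apply/eqP; rewrite eq_le -{2}z1; apply/andP; split.
    by rewrite -z1; exact: le_bigmax.
  by apply: bigmax_le => [|j _]; [exact: nu_ge0 | exact: imax (mem_index_enum j)].
have zi0 : z 0 i != 0 by rewrite -(nu_gt0 nuA) zi.
exists ((z 0 i)^-1 *: z); split; last by exists i; rewrite mxE mulVf.
apply: unit_coordsZ; first by rewrite (nuV nuA) zi invr1.
split=> //; last by exists i.
by move=> j; rewrite -z1; exact: le_bigmax.
Qed.

Lemma unit_coords_scale x y z : unit_coords x y -> unit_coords x z ->
  exists2 c, nu c = 1 & z = c *: y.
Proof.
move=> [yx y1 [i yi]] [zx z1 [k zk]]; have [c c0 zE] := hcoords_scale yx zx.
exists c => //; apply/eqP; rewrite eq_le; apply/andP; split.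
  by have := z1 i; rewrite zE mxE (nuM nuA) yi mulr1.
by rewrite -zk zE mxE (nuM nuA) ler_piMr ?nu_ge0.
Qed.

Lemma dist_leP m (H : 'I_m -> {mpoly K[N.+1]}) x y (eps : R) :
  (forall j, is_homogeneous (H j)) -> unit_coords x y -> 0 <= eps ->
  dist nu H x <= eps <-> forall j, nu (eval_at (H j) y) <= eps.
Proof.
move=> Hh yx e0; rewrite (distE nuA Hh (let: And3 h _ _ := yx in h) (unit_coords_sup yx)).
split=> [le j|le]; last exact: bigmax_le.
by apply: le_trans le; exact: le_bigmax.
Qed.

End Coordinates.

(** * Periodic points of a lift of Frobenius *)

Section FrobeniusLift.
Variables (R : realType) (K : fieldType) (nu : K -> R).
Hypothesis nuA : ultrametric_abs nu.
Variable p : nat.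
Hypotheses (p_pr : prime p) (p_lt1 : nu p%:R < 1) (p_nz : p%:R != 0 :> K).
Hypothesis teich_lift : forall y, nu y <= 1 -> exists2 t, teich p t & nu (y - t) < 1.
Variables (N s : nat) (p' : K) (P : 'I_N.+1 -> {mpoly K[N.+1]}).
Hypotheses (s_gt0 : (0 < s)%N) (p'_lt1 : nu p' < 1).
Hypotheses (P_homog : forall i, P i \is (p ^ s)%N.-homog) (P_int : forall i, integral nu (P i)).
Variable F : proj_space K N -> proj_space K N.
Let Phi := frobenius_coords (p ^ s)%N p' P.
Hypothesis FP : forall y x, hcoords y x -> hcoords (Phi y) (F x).
Implicit Types (x : proj_space K N) (y v u : 'rV[K]_N.+1).

Definition int_row y : Prop := forall i, nu (y 0 i) <= 1.

Lemma Phi_int y : int_row y -> int_row (Phi y).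
Proof.
move=> y1 i; rewrite mxE; apply: (nuD_le nuA); first exact: (nuX_le1 nuA).
by apply: (nuM_le1 nuA); [exact: ltW | apply: (meval_le nuA) => //; exact: P_int].
Qed.

Lemma iter_Phi_int r y : int_row y -> int_row (iter r Phi y).
Proof. by move=> y1; elim: r => //= r; exact: Phi_int. Qed.

Lemma Phi_near y i : int_row y -> nu (Phi y 0 i - y 0 i ^+ (p ^ s)) <= nu p'.
Proof.
move=> y1; rewrite mxE addrC addKr (nuM nuA) ler_piMr ?nu_ge0 //.
by apply: (meval_le nuA) => //; exact: P_int.
Qed.

Lemma Phi_unit y i : int_row y -> nu (y 0 i) = 1 -> nu (Phi y 0 i) = 1.
Proof.
move=> y1 yi; have yq : nu (y 0 i ^+ (p ^ s)) = 1 by rewrite (nuX nuA) yi expr1n.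
rewrite -[RHS]yq; apply: (nu_near_eq nuA); rewrite yq.
exact: le_lt_trans (Phi_near i y1) p'_lt1.
Qed.

Lemma iter_Phi_coords r x y : unit_coords nu x y -> unit_coords nu (iter r F x) (iter r Phi y).
Proof.
move=> xy; elim: r => //= r [zx z1 [i zi]]; split; [exact: FP | exact: Phi_int |].
by exists i; exact: Phi_unit.
Qed.

Lemma iter_PhiZ r c y : iter r Phi (c *: y) = c ^+ (p ^ (s * r)) *: iter r Phi y.
Proof.
elim: r => [|r IH]; first by rewrite muln0 expn0 expr1.
rewrite /= IH mulnS addnC expnD exprM; apply/rowP => i.
rewrite !mxE (eval_atZ _ _ (P_homog i)) exprMn.
by ring.
Qed.

(** Each step is a power map up to an error of norm at most [nu p'], and power maps do not expand
    distances between integral elements. *)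
Lemma iter_Phi_near r y i rho : int_row y -> nu p' <= rho ->
  nu (iter r Phi y 0 i - y 0 i ^+ (p ^ (s * r))) <= rho.
Proof.
move=> y1 p'rho; elim: r => [|r IH].
  by rewrite muln0 expn0 expr1 subrr (nu0 nuA); apply: le_trans p'rho; exact: nu_ge0.
rewrite iterS mulnS addnC expnD exprM.
apply: (nu_dist_le nuA) (le_trans (Phi_near i (iter_Phi_int r y1)) p'rho) _.
by apply: le_trans (distX_le nuA _ _ _) IH; [exact: iter_Phi_int | exact: (nuX_le1 nuA)].
Qed.

(** Each step gains a factor [rho]: on the power part by [distXpn_le], where [s_gt0] provides at
    least one factor, and on the perturbation from [nu p']. *)
Lemma iter_Phi_contract r y z rho :
  nu p%:R <= rho -> nu p' <= rho -> rho <= 1 -> int_row y -> int_row z ->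
  (forall i, nu (y 0 i - z 0 i) <= rho) ->
  forall i, nu (iter r Phi y 0 i - iter r Phi z 0 i) <= rho ^+ r.+1.
Proof.
move=> prho p'rho rho1 y1 z1 yz; have rho0 : 0 <= rho by apply: le_trans prho; exact: nu_ge0.
elim: r => [|r IH] i; first exact: yz.
have IH1 j : nu (iter r Phi y 0 j - iter r Phi z 0 j) <= rho.
  by apply: le_trans (IH j) _; rewrite exprS ler_piMr // exprn_ile1.
have [Y1 Z1] := (iter_Phi_int r y1, iter_Phi_int r z1).
rewrite !iterS /Phi /frobenius_coords !mxE opprD addrACA -mulrBr.
apply: (nuD_le nuA).
  apply: le_trans (distXpn_le nuA p_pr s prho rho1 (Y1 i) (Z1 i) (IH1 i)) _.
  rewrite [rho ^+ r.+2]exprS ler_pM ?exprn_ge0 ?nu_ge0 //.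
  by rewrite -[leRHS]expr1; apply: ler_wiXn2l.
rewrite (nuM nuA) [rho ^+ r.+2]exprS ler_pM ?nu_ge0 //.
by apply: (meval_dist_le nuA) => //; rewrite exprn_ge0.
Qed.

Definition rho0 : R := Num.max (nu p%:R) (nu p').

Lemma rho0_lt1 : rho0 < 1. Proof. by rewrite gt_max p_lt1. Qed.
Lemma rho0_p : nu p%:R <= rho0. Proof. by rewrite le_max lexx. Qed.
Lemma rho0_p' : nu p' <= rho0. Proof. by rewrite le_max lexx orbT. Qed.
Lemma rho0_gt0 : 0 < rho0. Proof. by apply: lt_le_trans rho0_p; rewrite (nu_gt0 nuA). Qed.

(* Applying a high iterate of F that fixes x improves any approximation of x to
   one of a precision independent of x. *)
Lemma periodic_teich x : periodic F x -> exists y u, [/\ unit_coords nu x y,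
  forall i, teich p (u 0 i) & forall i, nu (y 0 i - u 0 i) <= rho0].
Proof.
move=> [n n0 nx]; have [y [xy [i0 yi0]]] := unit_coords_ex1 nuA x.
have [_ y1 _] := xy.
have [i|w wP] := @choice _ _ (fun i t => teich p t /\ nu (y 0 i - t) < 1).
  by have [t] := teich_lift (y1 i); exists t.
pose W : 'rV[K]_N.+1 := \row_i w i.
have WT i : teich p (W 0 i) by rewrite mxE; exact: (wP i).1.
have W1 : int_row W by move=> i; exact: (teich_le1 nuA p_pr).
have [c0 /andP[c00 c01] c0P] := lt1_bound (fun i => (wP i).2).
(* [c] depends on [x]; enough contraction replaces it by the uniform [rho0]. *)
pose c := Num.max rho0 c0.
have c1 : c < 1 by rewrite gt_max rho0_lt1.
have cc0 : c0 <= c by rewrite le_max lexx orbT.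
have [M MP] := expr_small (le_trans c00 cc0) c1 rho0_gt0.
(* A multiple of the period, so that this iterate fixes [x], and at least [M], so that the
   contraction reaches [rho0]. *)
pose r := (n * M)%N.
have Fr : iter r F x = x.
  by rewrite /r; elim: (M) => [|k IH]; rewrite ?muln0 // mulnS iterD IH.
have close i : nu (iter r Phi y 0 i - W 0 i ^+ (p ^ (s * r))) <= rho0.
  apply: (nu_dist_le nuA) (iter_Phi_near r i W1 rho0_p').
  apply: le_trans (iter_Phi_contract (rho := c) r _ _ (ltW c1) y1 W1 _ i) _.
  - by apply: le_trans rho0_p _; rewrite le_max lexx.
  - by apply: le_trans rho0_p' _; rewrite le_max lexx.
  - by move=> k; rewrite mxE; apply: le_trans (c0P k) _; rewrite le_max lexx orbT.
  by apply: MP; apply: leqW; exact: leq_pmull.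
have rxy : unit_coords nu x (iter r Phi y) by have := iter_Phi_coords r xy; rewrite Fr.
have [l l1 lE] := unit_coords_scale nuA xy rxy.
pose tau i := W 0 i ^+ (p ^ (s * r)).
have tauT i : teich p (tau i) by exact: teichX.
have tauP i : nu (l * y 0 i - tau i) <= rho0 by have := close i; rewrite lE mxE.
have tau0 : nu (tau i0) = 1.
  rewrite -l1; apply: (nu_near_eq nuA); rewrite l1 (nu_distC nuA).
  by apply: le_lt_trans rho0_lt1; have := tauP i0; rewrite yi0 mulr1.
have t0 : tau i0 != 0 by rewrite -(nu_gt0 nuA) tau0.
(* As [y 0 i0 = 1], the scalar [l] is within [rho0] of [tau i0], and dividing by [tau i0] removes
   it. *)
exists y, (\row_i (tau i / tau i0)); split=> // i; rewrite mxE.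
  by apply: teichM => //; exact: teichV.
rewrite -[nu _]mul1r -l1 -(nuM nuA).
have -> : l * (y 0 i - tau i / tau i0) =
    (l * y 0 i - tau i) - (l * 1 - tau i0) * (tau i / tau i0) by field.
apply: (nuB_le nuA) => //; rewrite (nuM nuA).
apply: le_trans (_ : nu (l * 1 - tau i0) <= _).
  rewrite ler_piMr ?nu_ge0 // (nuM nuA) (nuV nuA) tau0 invr1 mulr1.
  exact: (teich_le1 nuA p_pr).
by rewrite -yi0.
Qed.

(** On a cycle a backward iterate is also a forward one. *)
Lemma periodic_pullback r x : periodic F x ->
  exists2 z, periodic F z & iter r F z = x.
Proof.
move=> [n n0 nx]; have Fk k : iter (n * k) F x = x.
  by elim: k => [|k IH]; rewrite ?muln0 // mulnS iterD IH.
exists (iter (n * r - r) F x).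
  by exists n => //; rewrite -iterD addnC iterD nx.
by rewrite -iterD subnKC ?Fk // leq_pmull.
Qed.

(** The bound between [z] and [u], improved by contraction, controls the equations at [x] with high
    precision; the last clause transfers conditions modulo the maximal ideal between the prescribed
    coordinates [v] and the same [u]. *)
Lemma periodic_rep r x v : periodic F x -> unit_coords nu x v ->
  exists z u, [/\ int_row z, forall i, teich p (u 0 i),
    forall i, nu (z 0 i - u 0 i) <= rho0,
    unit_coords nu x (iter r Phi z) &
    forall i, nu (v 0 i - u 0 i ^+ (p ^ (s * r))) < 1].
Proof.
move=> px xv; have [x' px' x'x] := periodic_pullback r px.
have [y [u [x'y uT yu]]] := periodic_teich px'.
have xy : unit_coords nu x (iter r Phi y) by rewrite -x'x; exact: iter_Phi_coords.
have [l l1 lE] := unit_coords_scale nuA xy xv.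
have [|t tT lt] := teich_lift (y := l); first by rewrite l1.
have t1 : nu t = 1.
  by rewrite -l1; apply: (nu_near_eq nuA); rewrite (nu_distC nuA) l1.
(* [iter r Phi] raises scalars to the power [p ^ (s * r)], so rescaling [y] by this root of [t]
   brings its image close to [v]. *)
have [t' t'T t'E] := teich_root (s * r) tT.
have t'1 : nu t' = 1.
  case: (teich_norm nuA p_pr t'T) => // t'0; move: t1; rewrite -t'E t'0.
  rewrite expr0n expn_eq0 (gtn_eqF (prime_gt0 p_pr)) /= (nu0 nuA) => /eqP.
  by rewrite eq_sym oner_eq0.
have [_ y1 _] := x'y; have [_ Y1 _] := xy.
have z1 : int_row (t' *: y) by move=> i; rewrite mxE (nuM nuA) t'1 mul1r.
have zu i : nu ((t' *: y) 0 i - (t' *: u) 0 i) <= rho0.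
  by rewrite !mxE -mulrBr (nuM nuA) t'1 mul1r.
have uT' i : teich p ((t' *: u) 0 i) by rewrite mxE; exact: teichM.
exists (t' *: y), (t' *: u); split=> //.
  by rewrite iter_PhiZ t'E; exact: unit_coordsZ.
move=> i; apply: (nu_dist_lt nuA (y := iter r Phi (t' *: y) 0 i)).
  rewrite iter_PhiZ t'E lE !mxE -mulrBl (nuM nuA); apply: le_lt_trans lt.
  by rewrite ler_piMr ?nu_ge0.
apply: le_lt_trans rho0_lt1.
apply: (nu_dist_le nuA) (iter_Phi_near r i z1 rho0_p') _.
apply: le_trans (zu i); apply: (distX_le nuA) => //.
exact: (teich_le1 nuA p_pr).
Qed.

Lemma iter_Phi_comp r (H : {mpoly K[N.+1]}) :
  exists G : {mpoly K[N.+1]}, forall y, G.@[y 0] = H.@[iter r Phi y 0].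
Proof.
elim: r H => [|r IH] H; first by exists H.
have [G GP] := IH H.
exists (G \mPo [tuple ('X_i ^+ (p ^ s) + p' *: P i) | i < N.+1]) => y.
rewrite iterSr -GP comp_mpoly_meval; apply: meval_eq => i.
by rewrite tnth_mktuple mevalD rmorphXn /= mevalXU mevalZ mxE.
Qed.

Variables (m : nat) (H : 'I_m -> {mpoly K[N.+1]}).
Hypotheses (H_homog : forall j, is_homogeneous (H j)) (H_int : forall j, integral nu (H j)).

(** The ideal, modulo the maximal ideal, of a sublevel set of periodic points. As [f] may be
    inhomogeneous, all normalised coordinates of a point are tested. *)
Definition sublevel_ideal (eps : R) (f : {mpoly K[N.+1]}) : Prop :=
  forall x y, periodic F x -> dist nu H x <= eps -> unit_coords nu x y -> nu f.@[y 0] < 1.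

(** At Teichmueller vectors the polynomials [H j] composed with [iter r Phi] are within [eps] of the
    values of [H j] at the periodic points. So [teich_sublevel_closed] yields a separating
    polynomial there, and its twist separates the periodic points themselves. *)
Lemma sublevel_closed (eps : R) x : 0 < eps -> periodic F x -> eps < dist nu H x ->
  exists f y, [/\ integral nu f, sublevel_ideal eps f, unit_coords nu x y & nu f.@[y 0] = 1].
Proof.
move=> e0 px ex.
(* The initial precision [rho0] and [r] contractions give [rho0 ^+ r.+1]. *)
have [r /(_ r.+1 (leqnSn r)) rP] := expr_small (ltW rho0_gt0) rho0_lt1 e0.
have [G GP] := choice (fun j => iter_Phi_comp r (H j)).
have T1 u : (forall i, teich p (u 0 i)) -> int_row u.
  by move=> uT i; apply: (teich_le1 nuA p_pr).
have GH z u j : int_row z -> (forall i, teich p (u 0 i)) ->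
    (forall i, nu (z 0 i - u 0 i) <= rho0) ->
    nu ((G j).@[u 0] - eval_at (H j) (iter r Phi z)) <= eps.
  move=> z1 uT zu; rewrite GP; apply: le_trans rP; rewrite (nu_distC nuA).
  apply: (meval_dist_le nuA) => //.
  - exact: iter_Phi_int.
  - exact/iter_Phi_int/T1.
  - exact/exprn_ge0/ltW/rho0_gt0.
  move=> i; apply: iter_Phi_contract => //.
  - exact: rho0_p.
  - exact: rho0_p'.
  - exact: ltW rho0_lt1.
  exact: T1.
have [v [xv _]] := unit_coords_ex1 nuA x.
have [z [u [z1 uT zu xz vu]]] := periodic_rep r px xv.
have [j Gj] : exists j, eps < nu (G j).@[u 0].
  apply: contrapT => nj; move: ex; rewrite ltNge => /negP; apply.
  apply/(dist_leP nuA H_homog xz (ltW e0)) => j.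
  have le : nu (G j).@[u 0] <= eps by rewrite leNgt; apply/negP => lt; apply: nj; exists j.
  by apply: (nu_near_le nuA) le; rewrite (nu_distC nuA); exact: GH.
have [f [f1 fu fP]] := teich_sublevel_closed nuA p_pr p_lt1 p_nz teich_lift e0 uT Gj.
have near (y w : 'rV[K]_N.+1) : int_row y -> (forall i, teich p (w 0 i)) ->
    (forall i, nu (y 0 i - w 0 i ^+ (p ^ (s * r))) < 1) ->
    (nu (coef_frob p (s * r) f).@[y 0] < 1) = (nu f.@[w 0] < 1).
  move=> y1 wT yw; have [c /andP[c0 c1] cP] := lt1_bound yw.
  rewrite -(meval_coef_frob_lt1 nuA p_pr p_lt1 (s * r) f1 (T1 _ wT)).
  have : nu ((coef_frob p (s * r) f).@[y 0] -
      (coef_frob p (s * r) f).@[fun i => w 0 i ^+ (p ^ (s * r))]) < 1.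
    apply: le_lt_trans c1; apply: (meval_dist_le nuA) => //.
      exact: coef_frob_integral.
    by move=> i; apply: (nuX_le1 nuA); exact: T1.
  move=> d; apply/idP/idP; last exact: (nu_near_lt nuA d).
  by apply: (nu_near_lt nuA); rewrite (nu_distC nuA).
have [_ v1 _] := xv.
exists (coef_frob p (s * r) f), v; split=> //.
- exact: coef_frob_integral.
- move=> x2 y px2 x2e x2y; have [_ y1 _] := x2y.
  have [z2 [u2 [z21 u2T z2u xz2 yu2]]] := periodic_rep r px2 x2y.
  rewrite (near _ u2) //; apply: fP => //.
  apply: (nu_near_le nuA) (GH _ _ j z21 u2T z2u) _.
  by apply: (dist_leP nuA H_homog xz2 (ltW e0)).1.
apply/eqP; rewrite eq_le; apply/andP; split.
  by apply: (meval_le nuA) => //; exact: coef_frob_integral.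
by rewrite leNgt (near _ u) // fu ltxx.
Qed.

(** The ideals at levels [pi ^+ i] stabilise. A periodic point below the stable level but above a
    later one would be separated by a member of the later ideal, which already belongs to the stable
    one. *)
Lemma dist_gap : exists2 delta : R, 0 < delta &
  forall x, periodic F x -> delta < dist nu H x \/ zero_locus H x.
Proof.
pose pi := nu p%:R; have pi0 : 0 < pi by rewrite (nu_gt0 nuA).
have [|||k f small x y px _ [_ y1 _]|i iP] :=
    noetherian_mod nuA (I := fun i => sublevel_ideal (pi ^+ i)).
- move=> i j f ij If x y px xj xy; apply: (If x y) => //; apply: le_trans xj _.
  by apply: ler_wiXn2l => //; exact: ltW.
- move=> i f g If Ig x y px xi xy; rewrite mevalB.
  by apply: (nuB_lt nuA); [exact: (If x y) | exact: (Ig x y)].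
- move=> i h f h1 If x y px xi xy; rewrite mevalM (nuM nuA).
  apply: le_lt_trans (If x y px xi xy); rewrite ler_piMl ?nu_ge0 //.
  by have [_ y1 _] := xy; apply: (meval_le nuA).
- exact: (meval_lt nuA).
exists (pi ^+ i); first exact: exprn_gt0.
move=> x px; have [xi|xi] := ltP (pi ^+ i) (dist nu H x); [by left | right].
have xj j : dist nu H x <= pi ^+ j.
  rewrite leNgt; apply/negP => /(sublevel_closed (exprn_gt0 j pi0) px).
  move=> [f [y [f1 If xy fy]]]; have := iP j f f1 If x y px xi xy.
  by rewrite fy ltxx.
have [y [xy _]] := unit_coords_ex1 nuA x.
have Hy j : eval_at (H j) y = 0.
  apply/eqP; rewrite -(nu_eq0 nuA); apply/negP => /negP Hy.
  have Hy0 : 0 < nu (eval_at (H j) y) / 2 by rewrite divr_gt0 // lt_def Hy nu_ge0.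
  have [n /(_ n (leqnn n)) nP] := expr_small (ltW pi0) p_lt1 Hy0.
  have := (dist_leP nuA H_homog xy (exprn_ge0 n (ltW pi0))).1 (xj n) j.
  move/le_trans/(_ nP); lra.
move=> z zx j; have [yx _ _] := xy; have [c c0 ->] := hcoords_scale yx zx.
by have [d Hd] := H_homog j; rewrite (eval_atZ _ _ Hd) Hy mulr0.
Qed.

End FrobeniusLift.

(** * From algebraic residues to Teichmueller lifts *)

Section TeichmuellerLift.
Variables (R : realType) (K : fieldType) (nu : K -> R).
Hypothesis nuA : ultrametric_abs nu.
Variable p : nat.
Hypotheses (p_pr : prime p) (p_lt1 : nu p%:R < 1).

Lemma nu_nat_lt1 k : (p %| k)%N -> nu k%:R < 1.
Proof.
move=> /dvdnP[l ->]; rewrite natrM (nuM nuA); apply: le_lt_trans p_lt1.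
by rewrite ler_piMl ?nu_ge0 ?(nu_nat_le1 nuA).
Qed.

Lemma nat_inv_mod k : ~~ (p %| k)%N -> exists w, nu (w%:R * k%:R - 1) < 1.
Proof.
rewrite -prime_coprime // coprime_sym => kp.
have k0 : (0 < k)%N.
  by case: k kp => //; rewrite /coprime gcd0n => /eqP p1; move: p_pr; rewrite p1.
case/(coprimeP _ k0): kp => -[a b] /= E; exists a.
have -> : a%:R * k%:R = 1 + (b * p)%:R :> K.
  by rewrite -natrM -(natrD _ 1) -E subnK // ltnW // -subn_gt0 E.
by rewrite addrC addKr nu_nat_lt1 // dvdn_mull.
Qed.

(* Modulo the maximal ideal the powers of Y take finitely many values, so two
   of the Frobenius iterates of Y coincide, and Frobenius is injective. *)
Lemma algebraic_frob (Y : K) n (z : nat -> nat) i0 : nu Y <= 1 ->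
  nu (\sum_(i < n) (z i)%:R * Y ^+ i) < 1 -> (i0 < n)%N -> ~~ (p %| z i0)%N ->
  exists2 k, (0 < k)%N & nu (Y ^+ (p ^ k) - Y) < 1.
Proof.
move=> Y1 zY i0n zi0.
have exP : exists i, (i < n)%N && ~~ (p %| z i)%N by exists i0; rewrite i0n.
have ubP i : (i < n)%N && ~~ (p %| z i)%N -> (i <= n)%N by case/andP => /ltnW.
(* [D] is the degree of the relation after reduction. *)
case: (ex_maxnP exP ubP) => D /andP[Dn zD] Dmax.
have X1 k : nu (Y ^+ k) <= 1 by exact: (nuX_le1 nuA).
have N1 k : nu k%:R <= 1 by exact: (nu_nat_le1 nuA).
(* Combinations of the powers of [Y] below [D], modulo the maximal ideal. Natural coefficients
   suffice, since -1 is congruent to [p.-1]. *)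
pose L x := exists c : nat -> nat, nu (x - \sum_(i < D) (c i)%:R * Y ^+ i) < 1.
have LD x y : L x -> L y -> L (x + y).
  move=> [c cx] [d dy]; exists (fun i => (c i + d i)%N).
  under eq_bigr do rewrite natrD mulrDl.
  by rewrite big_split /= opprD addrACA; exact: (nuD_lt nuA).
have L0 : L 0 by exists (fun=> 0%N); rewrite big1 ?subr0 ?(nu0 nuA) // => i _; rewrite mul0r.
have Lnat k x : L x -> L (k%:R * x).
  by move=> Lx; rewrite mulr_natl; elim: k => [|k IH]; rewrite ?mulr0n ?mulrS //; exact: LD.
have Lnear x y : L y -> nu (x - y) < 1 -> L x.
  by move=> [c cy] xy; exists c; exact: (nu_dist_lt nuA xy).
have Lsum m (F : nat -> K) : (forall i, (i < m)%N -> L (F i)) -> L (\sum_(i < m) F i).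
  by move=> LF; apply: (big_ind L L0 LD) => i _; exact: LF.
have LlowX i : (i < D)%N -> L (Y ^+ i).
  move=> iD; exists (fun j => (j == i :> nat) : nat).
  rewrite (bigD1 (Ordinal iD)) //= eqxx mul1r big1 ?addr0 ?subrr ?(nu0 nuA) //.
  by move=> j /negPf; rewrite -val_eqE /= => ->; rewrite mul0r.
have [w wD] := nat_inv_mod zD.
(* The reduced relation is solved for [Y ^+ D]: [w] inverts its leading coefficient, and [p.-1]
   supplies the sign. *)
have LXD : L (Y ^+ D).
  apply: (Lnear _ (\sum_(i < D) (w * p.-1 * z i)%:R * Y ^+ i)).
    apply: (Lsum D (fun i => (w * p.-1 * z i)%:R * Y ^+ i)) => i iD.
    by apply: (Lnat); exact: LlowX.
  have low : nu (\sum_(i < D.+1) (z i)%:R * Y ^+ i) < 1.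
    apply: (nu_near_lt nuA) zY; rewrite (nu_distC nuA).
    rewrite -!(big_mkord xpredT (fun i => (z i)%:R * Y ^+ i)).
    rewrite (big_cat_nat (n := D.+1)) //= [X in nu X]addrC addKr big_nat_cond.
    apply: (nu_sum_lt nuA) => // i; rewrite andbT => /andP[Di ile].
    rewrite (nuM nuA); apply: le_lt_trans (_ : nu (z i)%:R < 1).
      by rewrite ler_piMr ?nu_ge0.
    apply: nu_nat_lt1; apply: contraLR Di => pz; rewrite -leqNgt.
    by apply: Dmax; rewrite ile.
  rewrite big_ord_recr /= in low.
  set S := \sum_(i < D) _ in low.
  have -> : \sum_(i < D) (w * p.-1 * z i)%:R * Y ^+ i = (w * p.-1)%:R * S.
    by rewrite mulr_sumr; apply: eq_bigr => i _; rewrite natrM mulrA.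
  have pE : (w * p.-1)%:R = w%:R * p%:R - w%:R :> K.
    by rewrite -{2}(prednK (prime_gt0 p_pr)) -natr1 natrM; ring.
  have -> : Y ^+ D - (w * p.-1)%:R * S = w%:R * (S + (z D)%:R * Y ^+ D)
     - ((w%:R * (z D)%:R - 1) * Y ^+ D + p%:R * (w%:R * S)) by rewrite pE; ring.
  have S1 : nu S <= 1.
    by apply: (nu_sum_le nuA) => // i _; exact: (nuM_le1 nuA).
  apply: (nuB_lt nuA); last apply: (nuD_lt nuA); rewrite (nuM nuA).
  - by apply: le_lt_trans low; rewrite ler_piMl ?nu_ge0.
  - by apply: le_lt_trans wD; rewrite ler_piMr ?nu_ge0.
  - by apply: le_lt_trans p_lt1; rewrite ler_piMr ?nu_ge0 // (nuM_le1 nuA).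
have LX k : L (Y ^+ k).
  elim: k => [|k [c cP]].
    by have [D0|/LlowX //] := posnP D; rewrite -D0.
  apply: (Lnear _ (\sum_(i < D) (c i)%:R * Y ^+ i.+1)).
    apply: (Lsum D (fun i => (c i)%:R * Y ^+ i.+1)) => i iD; apply: (Lnat).
    by move: iD; rewrite leq_eqVlt => /predU1P[->//|]; exact: LlowX.
  have -> : Y ^+ k.+1 - \sum_(i < D) (c i)%:R * Y ^+ i.+1 =
      Y * (Y ^+ k - \sum_(i < D) (c i)%:R * Y ^+ i).
    rewrite mulrBr exprS mulr_sumr; congr (_ - _).
    by apply: eq_bigr => i _; rewrite exprS mulrCA.
  by rewrite (nuM nuA); apply: le_lt_trans cP; rewrite ler_piMl ?nu_ge0.
have p0 := prime_gt0 p_pr.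
(* Taking the coefficients modulo [p] leaves finitely many combinations, ready for the pigeonhole
   principle. *)
have fin k : exists c : {ffun 'I_D -> 'I_p},
    nu (Y ^+ (p ^ k) - \sum_(i < D) (c i)%:R * Y ^+ i) < 1.
  have [c cP] := LX (p ^ k)%N.
  exists [ffun i : 'I_D => Ordinal (ltn_pmod (c i) p0)].
  apply: (nu_dist_lt nuA cP); rewrite -sumrB; apply: (nu_sum_lt nuA) => // i _.
  rewrite ffunE /= -mulrBl {1}(divn_eq (c i) p) natrD addrK (nuM nuA).
  apply: le_lt_trans (nu_nat_lt1 (dvdn_mull (c i %/ p) (dvdnn p))).
  by rewrite ler_piMr ?nu_ge0.
have [c cP] := choice fin.
have [i [j [ij cij]]] : exists i j, (i < j)%N /\ c i = c j.
  apply: contrapT => no.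
  pose h (i : 'I_(#|{ffun 'I_D -> 'I_p}|.+1)) := c i.
  have /(leq_card h) : injective h.
    move=> i j; rewrite /h => cij; apply: val_inj; apply/eqP.
    rewrite eqn_leq; apply/andP; split; rewrite leqNgt; apply/negP => lt.
      by apply: no; exists j, i.
    by apply: no; exists i, j.
  by rewrite card_ord ltnn.
exists (j - i)%N; first by rewrite subn_gt0.
apply: (frob_inj_mod nuA p_pr p_lt1 (r := i)) => //.
rewrite -exprM -expnD subnK ?(ltnW ij) //.
by apply: (nu_dist_lt nuA (cP j)); rewrite -cij (nu_distC nuA).
Qed.

Hypothesis complete : forall u, cauchy_seq nu u -> exists l, seq_limit nu u l.

(** The powers [y ^+ (p ^ (k * i))] form a Cauchy sequence inside the residue class of [y], and its
    limit is fixed by the [p ^ k]-th power map. *)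
Lemma frob_limit y k : nu y <= 1 -> (0 < k)%N -> nu (y ^+ (p ^ k) - y) < 1 ->
  exists2 t, teich p t & nu (y - t) < 1.
Proof.
move=> y1 k0 yk; pose u i := y ^+ (p ^ (k * i)).
have u1 i : nu (u i) <= 1 by exact: (nuX_le1 nuA).
pose rho := Num.max (nu p%:R) (nu (y ^+ (p ^ k) - y)).
have rho1 : rho < 1 by rewrite gt_max p_lt1.
have prho : nu p%:R <= rho by rewrite le_max lexx.
have rho0 : 0 <= rho by apply: le_trans prho; exact: nu_ge0.
have ustep i : nu (u i.+1 - u i) <= rho ^+ i.
  rewrite /u mulnS expnD exprM.
  apply: le_trans (distXpn_le nuA p_pr (rho := rho) _ _ _ _ _ _) _ => //.
  - exact: ltW.
  - exact: (nuX_le1 nuA).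
  - by rewrite le_max lexx orbT.
  apply: le_trans (_ : rho ^+ (k * i) <= _).
    by rewrite ler_piMr ?exprn_ge0 // ltW.
  by apply: ler_wiXn2l; rewrite ?leq_pmull // ltW.
have udist i d : nu (u (i + d)%N - u i) <= rho ^+ i.
  elim: d => [|d IH]; first by rewrite addn0 subrr (nu0 nuA) exprn_ge0.
  apply: (nu_dist_le nuA) IH; rewrite addnS; apply: le_trans (ustep _) _.
  by apply: ler_wiXn2l; rewrite ?leq_addr // ltW.
have [|l lP] := complete (u := u).
  move=> e e0; have [N NP] := expr_small rho0 rho1 (divr_gt0 e0 (ltr0n _ 2)).
  have half : e / 2 < e by lra.
  exists N => a b Na Nb; apply: (nu_dist_lt nuA (y := u N)).
    by rewrite -(subnKC Na); apply: le_lt_trans half; apply: le_trans (udist _ _) (NP N _).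
  rewrite (nu_distC nuA) -(subnKC Nb).
  by apply: le_lt_trans half; apply: le_trans (udist _ _) (NP N _).
have l1 : nu l <= 1.
  have [N /(_ N (leqnn N)) NP] := lP 1 ltr01.
  by apply: (nu_near_le nuA) (u1 N); rewrite (nu_distC nuA) ltW.
exists l.
  exists k => //; apply/eqP; rewrite -subr_eq0 -(nu_eq0 nuA); apply/negP => /negP ne.
  have e0 : 0 < nu (l ^+ (p ^ k) - l) by rewrite lt_def ne nu_ge0.
  have [N NP] := lP _ e0.
  have : nu (l ^+ (p ^ k) - l) < nu (l ^+ (p ^ k) - l).
    apply: (nu_dist_lt nuA (y := u N.+1)); last exact: NP.
    rewrite {1}/u mulnS addnC expnD exprM (nu_distC nuA).
    by apply: le_lt_trans (distX_le nuA _ (u1 N) l1) (NP N _).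
  by rewrite ltxx.
have [N /(_ N (leqnn N)) NP] := lP 1 ltr01.
apply: (nu_dist_lt nuA (y := u N)) => //; rewrite (nu_distC nuA).
elim: (N) => [|i IH]; first by rewrite /u muln0 expn0 expr1 subrr (nu0 nuA).
apply: (nu_dist_lt nuA (y := y ^+ (p ^ k))) => //.
rewrite /u mulnS addnC expnD exprM.
by apply: le_lt_trans (distX_le nuA _ (u1 i) y1) IH.
Qed.

End TeichmuellerLift.

(** * Residues and Teichmueller lifts in the complex p-adic field *)

Section ComplexPadics.
Variables (R : realType) (p : nat) (Cp : fieldType) (nu : Cp -> R).
Hypotheses (p_pr : prime p) (CpP : is_Cp p nu).

Lemma Cp_abs : ultrametric_abs nu.
Proof. by case: CpP => [? [? [? [? [? [? [? [_ _ _ _ []]]]]]]]]. Qed.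

Lemma Cp_complete u : cauchy_seq nu u -> exists l, seq_limit nu u l.
Proof. case: CpP => [? [? [? [? [? [? [? [_ _ _ _ []]]]]]]]] _ _ _; exact. Qed.

Lemma padic_abs_p : padic_abs R p p%:R = p%:R^-1.
Proof.
have p0 : p%:R != 0 :> rat by rewrite pnatr_eq0 -lt0n prime_gt0.
have zE : p%:R = (p : int)%:~R :> rat by rewrite -pmulrn.
rewrite /padic_abs (negPf p0) zE.
rewrite numq_int denq_int /= logn1 lognE p_pr prime_gt0 // dvdnn.
by rewrite divnn prime_gt0 //= logn1 sub0r exprN1.
Qed.

Lemma Cp_p_norm : nu p%:R = p%:R^-1.
Proof.
case: CpP => [? [? [nuQp [nuQpb [i [j [k [Qp _ _ jP Cpl]]]]]]]].
rewrite -(rmorph_nat k) (completion_isometry Cpl) -(rmorph_nat j) jP.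
by rewrite -(rmorph_nat i) (completion_isometry Qp) padic_abs_p.
Qed.

Lemma Cp_p_lt1 : nu p%:R < 1.
Proof. by rewrite Cp_p_norm invf_lt1 ?ltr1n ?ltr0n ?prime_gt0 ?prime_gt1. Qed.

Lemma Cp_p_nz : p%:R != 0 :> Cp.
Proof.
by rewrite -(nu_gt0 Cp_abs) Cp_p_norm invr_gt0 ltr0n prime_gt0.
Qed.

Lemma padic_abs_le1 (r : rat) : padic_abs R p r <= 1 -> ~~ (p %| `|denq r|)%N.
Proof.
rewrite /padic_abs; have [->|r0] := eqVneq r 0.
  by rewrite (_ : denq 0 = 1) //= Euclid_dvd1.
apply: contraTN => pd; rewrite -ltNge.
have pn : ~~ (p %| `|numq r|)%N.
  apply/negP => pn; have := coprime_num_den r; rewrite /coprime => /eqP g1.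
  have : (p %| gcdn `|numq r| `|denq r|)%N by rewrite dvdn_gcd pn.
  by rewrite g1 Euclid_dvd1.
rewrite [logn p `|numq r|](_ : _ = 0%N); last first.
  by apply/eqP; rewrite -leqn0 leqNgt logn_gt0 mem_primes p_pr (negPf pn) andbF.
have : (0 < logn p `|denq r|)%N by rewrite logn_gt0 mem_primes p_pr absz_gt0 denq_neq0.
case: (logn _ _) => // l _; rewrite subr0 -exprnP exprn_egt1 // ltr1n prime_gt1 //.
Qed.

Lemma Cp_int_near (z : int) : exists k : nat, nu (z%:~R - k%:R) < 1.
Proof.
case: z => k; first by exists k; rewrite -pmulrn subrr (nu0 Cp_abs).
exists (k.+1 * p.-1)%N; rewrite NegzE rmorphN /= -pmulrn -opprD (nuN Cp_abs).
rewrite -natrD -mulnS prednK ?prime_gt0 //.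
by apply: (nu_nat_lt1 Cp_abs Cp_p_lt1); exact: dvdn_mull.
Qed.

(** The residue field is algebraic over the prime field: [y] is close to some [Y] algebraic over
    [Qp], and an equation of [Y] is rescaled and its coefficients are replaced by natural numbers
    before [algebraic_frob] applies. *)
Lemma Cp_residue (y : Cp) : nu y <= 1 ->
  exists2 n, (0 < n)%N & nu (y ^+ (p ^ n) - y) < 1.
Proof.
have nuA := Cp_abs; have plt := Cp_p_lt1.
case: CpP => [Qp [Qpb [nuQp [nuQpb [i [j [k [QpP [jalg _] _ jP CplP]]]]]]]] y1.
have [Y yY] := completion_dense CplP y ltr01.
have Y1 : nu (k Y) <= 1 by apply: (nu_near_le nuA) y1; rewrite (nu_distC nuA) ltW.
have nuP a : nu (k (j a)) = nuQp a by rewrite (completion_isometry CplP) jP.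
(* An integral element of [Qp] is close to a rational whose denominator is prime to [p], hence
   invertible modulo the maximal ideal by a natural number. *)
have near_nat (a : Qp) : nu (k (j a)) <= 1 -> exists z : nat, nu (k (j a) - z%:R) < 1.
  move=> a1; have [r ar] := completion_dense QpP a ltr01.
  pose f (x : rat) := k (j (i x)).
  have {}ar : nu (k (j a) - f r) < 1 by rewrite /f -!rmorphB nuP.
  have r1 : nu (f r) <= 1 by apply: (nu_near_le nuA) a1; rewrite (nu_distC nuA) ltW.
  have pd : ~~ (p %| `|denq r|)%N.
    by apply: padic_abs_le1; rewrite -(completion_isometry QpP) -nuP.
  have [w wP] := nat_inv_mod nuA p_pr plt pd.
  have [n nP] := Cp_int_near (numq r).
  exists (w * n)%N; apply: (nu_dist_lt nuA ar).
  have fE : f r * `|denq r|%:R = (numq r)%:~R.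
    have -> : (`|denq r|%:R : Cp) = f (denq r)%:~R.
      by rewrite /f !rmorph_int -[in RHS](gez0_abs (denq_ge0 r)).
    rewrite /f -!rmorphM -{1}(divq_num_den r) divfK ?intr_eq0 ?denq_neq0 //.
    by rewrite !rmorph_int.
  rewrite natrM (_ : f r - _ = w%:R * ((numq r)%:~R - n%:R) - (w%:R * `|denq r|%:R - 1) * f r).
    apply: (nuB_lt nuA); rewrite (nuM nuA).
      by apply: le_lt_trans nP; rewrite ler_piMl ?nu_ge0 ?(nu_nat_le1 nuA).
    by apply: le_lt_trans wP; rewrite ler_piMr ?nu_ge0.
  by rewrite -fE; ring.
have [P P0 Proot] := jalg Y.
pose Q i := k (j P`_i).
(* Division by a coefficient of largest norm makes the equation integral with one coefficient equal
   to 1, so its reduction is not zero. *)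
have [i0 i0P Qmax] : exists2 i0, i0 \in iota 0 (size P) &
    forall l, l \in iota 0 (size P) -> nu (Q l) <= nu (Q i0).
  apply: (seq_argmax (fun l => nu (Q l)) (x := 0%N)).
  by rewrite mem_iota /= add0n size_poly_gt0.
have Q0 : Q i0 != 0.
  rewrite -(nu_gt0 nuA); apply: lt_le_trans (Qmax (size P).-1 _); last first.
    by rewrite mem_iota /= add0n prednK ?size_poly_gt0.
  by rewrite (nu_gt0 nuA) !fmorph_eq0 -lead_coefE lead_coef_eq0.
have Q01 : 0 < nu (Q i0) by rewrite (nu_gt0 nuA).
have [z zP] : {z : nat -> nat & forall l, (l < size P)%N -> nu (Q l / Q i0 - (z l)%:R) < 1}.
  apply: (choice (P := fun l z => (l < size P)%N -> nu (Q l / Q i0 - z%:R) < 1)) => l.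
  have [lP|] := ltnP l (size P); last by exists 0%N.
  have [|z zP] := near_nat (P`_l / P`_i0).
    rewrite !fmorph_div (nuM nuA) (nuV nuA) ler_pdivrMr // mul1r.
    by apply: Qmax; rewrite mem_iota.
  by exists z => _; move: zP; rewrite !fmorph_div.
have i0lt : (i0 < size P)%N by move: i0P; rewrite mem_iota.
have [||n n0 nP] := algebraic_frob nuA p_pr plt (z := z) (n := size P) (i0 := i0) Y1 _ i0lt.
- have QY : \sum_(l < size P) Q l / Q i0 * k Y ^+ l = 0.
    have := congr1 k (rootP Proot); rewrite rmorph0.
    rewrite (@horner_coef_wide _ (size P)) ?size_map_poly //.
    rewrite rmorph_sum /= => /(congr1 (fun x => x / Q i0)); rewrite mul0r mulr_suml => E.
    rewrite -[RHS]E; apply: eq_bigr => l _.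
    by rewrite rmorphM rmorphXn coef_map /= mulrAC.
  suff : nu (\sum_(l < size P) (z l)%:R * k Y ^+ l
      - \sum_(l < size P) Q l / Q i0 * k Y ^+ l) < 1.
    by rewrite QY subr0.
  rewrite -sumrB; apply: (nu_sum_lt nuA) => // l _.
  rewrite -mulrBl (nuM nuA) (nu_distC nuA).
  by apply: le_lt_trans (zP l (ltn_ord l)); rewrite ler_piMr ?nu_ge0 ?(nuX_le1 nuA).
- apply/negP => /(nu_nat_lt1 nuA plt) z1; have := zP i0 i0lt.
  rewrite divff // => /(nu_near_lt nuA) /(_ z1).
  by rewrite (nu1 nuA) ltxx.
exists n => //; apply: (nu_dist_lt nuA (y := k Y ^+ (p ^ n))).
  exact: le_lt_trans (distX_le nuA _ y1 Y1) yY.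
by apply: (nu_dist_lt nuA nP); rewrite (nu_distC nuA).
Qed.

Lemma Cp_teich_lift (y : Cp) : nu y <= 1 -> exists2 t, teich p t & nu (y - t) < 1.
Proof.
move=> y1; have [n n0 yn] := Cp_residue y1.
exact: (frob_limit Cp_abs p_pr Cp_p_lt1 Cp_complete y1 n0 yn).
Qed.

End ComplexPadics.

Theorem theorem1p2 (R : realType) (p : nat) (Cp : fieldType) (nu : Cp -> R)
    (N : nat) (F : proj_space Cp N -> proj_space Cp N)
    (V : proj_space Cp N -> Prop) (m : nat) (H : 'I_m -> {mpoly Cp[N.+1]}) :
  prime p ->
  is_Cp p nu ->
  frobenius_lift p nu F ->
  irreducible_subvariety V ->
  (forall j, is_homogeneous (H j)) ->
  (forall j, gauss_norm nu (H j) = 1) ->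
  (forall x, V x <-> zero_locus H x) ->
  exists2 delta : R, 0 < delta &
    forall x, periodic F x -> delta < dist nu H x \/ V x.
Proof.
move=> p_pr CpP [s [p' [P [s_gt0 p'_lt1 P_homog P_int FP]]]] _ H_homog H_norm VH.
have nuA := Cp_abs CpP.
have H_int j : integral nu (H j).
  move=> k; rewrite -(H_norm j) /gauss_norm.
  have [kH|/memN_msupp_eq0 ->] := boolP (k \in msupp (H j)); first exact: le_bigmax_seq.
  by rewrite (nu0 nuA); exact: bigmax_ge_id.
have [delta d0 dP] := dist_gap nuA p_pr (Cp_p_lt1 p_pr CpP) (Cp_p_nz p_pr CpP)
  (Cp_teich_lift p_pr CpP) s_gt0 p'_lt1 P_homog P_int FP H_homog H_int.
by exists delta => // x /dP [?|/VH]; [left | right].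
Qed.
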